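(* Let $A$ be either the noncommutative $2$-torus $C(\mathbb{T}^2_\theta)$ (for a real parameter $\theta$) or the reduced group $C^*$-algebra $C^*_r(\mathbb{F}_2)$ of the free group on two generators, and let $\tau$ be the $\mathbb{T}^2$-invariant tracial state on $A$. Then the canonical calculus of rank two on $A$ satisfies the Gauss-Bonnet theorem: $\int_\tau\Omega_{12}^k$ is independent of the smooth deformation parameter $k$.
   Context: The algebras. $C(\mathbb{T}^2_\theta)$ is the universal $C^*$-algebra generated by unitaries $U_1,U_2$ with $U_1U_2=e^{2\pi i\theta}U_2U_1$; put $S_i=U_i$. For $C^*_r(\mathbb{F}_2)$, $S_1,S_2$ are the unitaries corresponding to the free generators. In each case $\mathcal{A}$ denotes the dense $*$-subalgebra generated by $S_1,S_2$ (for $\mathbb{F}_2$ it is $\mathbb{C}[\mathbb{F}_2]$). The $\mathbb{T}^2$-action $(\lambda_1,\lambda_2)\cdot S_j=\lambda_jS_j$ yields derivations $\partial_1,\partial_2$ of $\mathcal{A}$ with $\partial_i(S_j)=\delta_{ij}S_i$, $\partial_i(S_j^* )=-\delta_{ij}S_j^*$. Each algebra has a unique $\mathbb{T}^2$-invariant tracial state $\tau$: for the torus, $\tau(U_1^mU_2^n)=0$ unless $m=n=0$, and for $\mathbb{F}_2$ the canonical trace. A smooth deformation parameter is an invertible $k\in A$ with $k,k^{-1}\in\mathcal{A}$. General notions. A differential calculus on a complex algebra $\mathcal{A}$ is a differential graded algebra $(\Omega(\mathcal{A}),\wedge,d)$ with $\Omega^0(\mathcal{A})=\mathcal{A}$,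 generated in degree zero. It is quasi-tame if $\Omega^1(\mathcal{A})$ is a finitely generated projective right module, $\Omega^1(\mathcal{A})\otimes_{\mathcal{A}}\Omega^1(\mathcal{A})=\mathrm{Ker}(\wedge)\oplus\mathcal{F}$ as right modules with $\mathcal{F}\cong\Omega^2(\mathcal{A})$, and the idempotent $P_{\rm sym}$ with range $\mathrm{Ker}(\wedge)$ and kernel $\mathcal{F}$ is a bimodule map; put $\sigma=2P_{\rm sym}-1$. It is tame if moreover $\mathcal{Z}(\Omega^1(\mathcal{A}))\otimes_{\mathcal{Z}(\mathcal{A})}\mathcal{A}\to\Omega^1(\mathcal{A})$, $\sum e_i\otimes a_i\mapsto\sum e_ia_i$, is an isomorphism ($\mathcal{Z}$ denotes center) and $\sigma(\omega\otimes\eta)=\eta\otimes\omega$ for central $\omega,\eta$. A pseudo-Riemannian metric is a right $\mathcal{A}$-linear $g:\Omega^1(\mathcal{A})\otimes_{\mathcal{A}}\Omega^1(\mathcal{A})\to\mathcal{A}$ with $g\circ\sigma=g$ and $\omega\mapsto g(\omega\otimes\,\cdot\,)$ an isomorphism $\Omega^1(\mathcal{A})\to\mathrm{Hom}_{\mathcal{A}}(\Omega^1(\mathcal{A}),\mathcal{A})$; it is strongly $\sigma$-compatible if its values on pairs of central one-forms commute with each other. A connection is a $\mathbb{C}$-linear $\nabla:\Omega^1(\mathcal{A})\to\Omega^1(\mathcal{A})\otimes_{\mathcal{A}}\Omega^1(\mathcal{A})$ with $\nabla(ea)=\nabla(e)a+e\otimes da$; it is Levi-Civita for $g$ if $\wedge\circ\nabla+d=0$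 and $\Pi_g(\nabla)=d\circ g$, where $\Pi_g(\nabla)(\omega\otimes\eta a)=(g\otimes\mathrm{id})\sigma_{23}(\nabla(\omega)\otimes\eta+\nabla(\eta)\otimes\omega)\,a+g(\omega\otimes\eta)\,da$ for central $\omega,\eta$ and $a\in\mathcal{A}$, $\sigma_{23}=\mathrm{id}\otimes\sigma$. On a tame calculus admitting a bilinear metric, each strongly $\sigma$-compatible metric has a unique Levi-Civita connection (known). Canonical calculus of rank two. Fix a faithful state $\tau_0$ on $A$, let $\mathcal{D}=\partial_1\otimes\gamma_1+\partial_2\otimes\gamma_2$ on $L^2(A,\tau_0)\otimes\mathbb{C}^2$, with $\gamma_i^2=1$, $\gamma_1\gamma_2=-\gamma_2\gamma_1$, and $a\in\mathcal{A}$ acting as $a\otimes1$. The calculus is Connes' calculus $\Omega^k(\mathcal{A})=\Pi(\Omega^k_u(\mathcal{A}))/\Pi(\delta J_0^{k-1})$, where $(\Omega^\bullet_u(\mathcal{A}),\delta)$ is the reduced universal differential graded algebra, $\Pi(a_0\delta a_1\cdots\delta a_k)=a_0[\mathcal{D},a_1]\cdots[\mathcal{D},a_k]$, $J_0^k=\ker\Pi|_{\Omega_u^k(\mathcal{A})}$. It is tame; $\Omega^1(\mathcal{A})$ is the free bimodule with central basis $e_i=1\otimes\gamma_i$, $d(a)=\sum_ie_i\partial_i(a)$, $d(e_i)=0$, $e_i\wedge e_j=-e_j\wedge e_i$, and $\Omega^2(\mathcal{A})$ is free of rank one with basis $e_1\wedge e_2$. Its canonical bilinear metric is $g_0(\sum_{i,j}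 e_i\otimes e_ja_{ij})=\sum_ia_{ii}$. Gauss-Bonnet form. For a smooth deformation parameter $k$, $kg_0$ is the strongly $\sigma$-compatible metric $kg_0(\sum_{i,j} e_i\otimes e_ja_{ij})=\sum_i ka_{ii}$. With the Christoffel symbols of its Levi-Civita connection $\nabla$ defined by $\nabla(e_i)=\sum_{j,l}e_j\otimes e_l\Gamma^i_{jl}$, put $$\Omega^k_{12}=e_1\wedge e_2\Big(\sum_{p=1}^2(\Gamma^p_{21}\Gamma^1_{p2}-\Gamma^p_{22}\Gamma^1_{p1})-\partial_2(\Gamma^1_{21})+\partial_1(\Gamma^1_{22})\Big).$$ For $\theta'=e_1\wedge e_2\,a\in\Omega^2(\mathcal{A})$ with $a\in\mathcal{A}$, put $\int_\tau\theta':=\tau(a)$. *)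

(* Defs.v *)
From HB Require Import structures.
From mathcomp Require Import all_boot all_order all_algebra.
From mathcomp Require Import generic_quotient complex.
From mathcomp Require Import all_classical all_reals all_analysis.
Import numFieldNormedType.Exports.

Set Implicit Arguments.
Unset Strict Implicit.
Unset Printing Implicit Defensive.

Import Order.TTheory GRing.Theory Num.Theory.
Local Open Scope classical_set_scope.
Local Open Scope ring_scope.
Local Open Scope quotient_scope.

(** * C*-algebras and Hilbert spaces over [R[i]] *)

HB.mixin Record isCStarAlgebra (R : realType) A of GRing.Algebra R[i] A := {
  star : A -> A;
  starD : forall x y, star (x + y) = star x + star y;
  starZ : forall (c : R[i]) x, star (c *: x) = c^* *: star x;
  starM : forall x y, star (x * y) = star y * star x;
  starK : forall x, star (star x) = x;
  cnorm : A -> R;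
  cnorm_eq0 : forall x, cnorm x = 0 -> x = 0;
  cnormD : forall x y, cnorm (x + y) <= cnorm x + cnorm y;
  cnormZ : forall (c : R[i]) x, (cnorm (c *: x))%:C%C = `|c| * (cnorm x)%:C%C;
  cnormM : forall x y, cnorm (x * y) <= cnorm x * cnorm y;
  cnorm_star : forall x, cnorm (star x * x) = cnorm x ^+ 2;
  cnorm_complete : forall u : nat -> A,
    (forall eps : R, 0 < eps -> exists N, forall m n,
      (N <= m)%N -> (N <= n)%N -> cnorm (u m - u n) < eps) ->
    exists l, forall eps : R, 0 < eps -> exists N, forall n,
      (N <= n)%N -> cnorm (u n - l) < eps
}.

#[short(type="cstarType")]
HB.structure Definition CStarAlgebra (R : realType) :=
  {A of isCStarAlgebra R A & GRing.Algebra R[i] A}.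

(* The inner product is linear in its second variable; the norm of [H] takes its
   values in the nonnegative elements of [R[i]], and [0 <= z] in [R[i]] means that
   [z] is a nonnegative real. *)
HB.mixin Record isHilbert (R : realType) H of CompleteNormedModule R[i] H := {
  dot : H -> H -> R[i];
  dotC : forall x y, dot y x = (dot x y)^*;
  dotDr : forall x y z, dot x (y + z) = dot x y + dot x z;
  dotZr : forall (c : R[i]) x y, dot x (c *: y) = c * dot x y;
  dot_norm : forall x : H, dot x x = `|x| ^+ 2
}.

#[short(type="hilbertType")]
HB.structure Definition Hilbert (R : realType) :=
  {H of isHilbert R H & CompleteNormedModule R[i] H}.

Section CStar.
Context {R : realType} {A : cstarType R}.

Definition unitary (u : A) : Prop := star u * u = 1 /\ u * star u = 1.

Definition star_hom {B : cstarType R} (f : A -> B) : Prop :=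
  [/\ forall (c : R[i]) x y, f (c *: x + y) = c *: f x + f y,
      forall x y, f (x * y) = f x * f y,
      f 1 = 1
    & forall x, f (star x) = star (f x)].

Definition star_subalg (P : set A) : Prop :=
  [/\ P 1,
      forall (c : R[i]) x y, P x -> P y -> P (c *: x + y),
      forall x y, P x -> P y -> P (x * y)
    & forall x, P x -> P (star x)].

Definition star_gen (X : set A) : set A :=
  [set x | forall P : set A, star_subalg P -> X `<=` P -> P x].

Definition cstar_generated_by (X : set A) : Prop :=
  forall x (eps : R), 0 < eps -> exists2 y, star_gen X y & cnorm (x - y) < eps.

Definition state (phi : A -> R[i]) : Prop :=
  [/\ forall (c : R[i]) x y, phi (c *: x + y) = c * phi x + phi y,
      forall x, 0 <= phi (star x * x)
    & phi 1 = 1].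

Definition faithful_state (phi : A -> R[i]) : Prop :=
  state phi /\ forall x, phi (star x * x) = 0 -> x = 0.

Definition tracial_state (phi : A -> R[i]) : Prop :=
  state phi /\ forall x y, phi (x * y) = phi (y * x).

Definition star_rep {H : hilbertType R} (pi : A -> H -> H) : Prop :=
  [/\ forall a (c : R[i]) v w, pi a (c *: v + w) = c *: pi a v + pi a w,
      forall a, continuous (pi a),
      forall (c : R[i]) a b v, pi (c *: a + b) v = c *: pi a v + pi b v,
      (forall a b v, pi (a * b) v = pi a (pi b v)) /\ (forall v, pi 1 v = v)
    & forall a v w, dot (pi a v) w = dot v (pi (star a) w)].

(* [(H, pi, xi)] is the GNS triple of [phi], i.e. [H = L^2(A, phi)] with [A]
   acting by left multiplication and [pi a xi] the class of [a] in [H]. *)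
Definition GNS {H : hilbertType R} (phi : A -> R[i]) (pi : A -> H -> H) (xi : H) :
    Prop :=
  [/\ star_rep pi,
      forall a, phi a = dot xi (pi a xi)
    & closure [set pi a xi | a in setT] = setT].

End CStar.

(** * The two algebras *)

Definition nc_torus (R : realType) (A : cstarType R) (theta : R) (U : 'I_2 -> A) :
    Prop :=
  let relations (B : cstarType R) (V : 'I_2 -> B) :=
    (forall i, unitary (V i)) /\
    V ord0 * V ord_max =
      (cos (2 * pi * theta) +i* sin (2 * pi * theta))%C *: (V ord_max * V ord0) in
  [/\ relations A U,
      cstar_generated_by (range U)
    & forall (B : cstarType R) (V : 'I_2 -> B), relations B V ->
        exists f : A -> B, star_hom f /\ forall i, f (U i) = V i].

Definition free_group_on (I : Type) (F : groupType) (s : I -> F) : Prop :=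
  forall (G : groupType) (y : I -> G),
    exists! f : F -> G, {morph f : x z / (x * z)%g} /\ forall i, f (s i) = y i.

Definition orthonormal_basis (R : realType) (H : hilbertType R) (I : eqType)
    (b : I -> H) : Prop :=
  (forall i j, dot (b i) (b j) = (i == j)%:R) /\
  (forall v, (forall i, dot (b i) v = 0) -> v = 0).

(* [A] is [C*_r(G)] with canonical unitaries [u]: [A] is generated by [u] and
   acts faithfully on [l^2(G)] so that [u] is the left regular representation. *)
Definition reduced_group_cstar (R : realType) (G : groupType) (A : cstarType R)
    (u : G -> A) : Prop :=
  cstar_generated_by (range u) /\
  exists (H : hilbertType R) (lambda : A -> H -> H) (delta : G -> H),
    [/\ star_rep lambda,
        forall a, (forall v, lambda a v = 0) -> a = 0,
        orthonormal_basis delta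
      & forall g h, lambda (u g) (delta h) = delta (g * h)%g].

Definition reduced_free_group_cstar (R : realType) (A : cstarType R)
    (S : 'I_2 -> A) : Prop :=
  exists (F : groupType) (s : 'I_2 -> F) (u : F -> A),
    [/\ free_group_on s, reduced_group_cstar u & forall i, S i = u (s i)].

(** * The smooth subalgebra generated by [S] *)

Section Smooth.
Context {R : realType} {A : cstarType R} (S : 'I_2 -> A).

Definition smooth_pred : {pred A} := fun x => `[< star_gen (range S) x >].

Lemma smooth_pred_closed : subalg_closed smooth_pred.
Proof.
split.
- by apply/asboolP => P [].
- move=> c x y /asboolP hx /asboolP hy; apply/asboolP => P hP hS.
  by have [_ + _ _] := hP; apply; [apply: hx | apply: hy].
- move=> x y /asboolP hx /asboolP hy; apply/asboolP => P hP hS.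
  by have [_ _ + _] := hP; apply; [apply: hx | apply: hy].
Qed.

HB.instance Definition _ :=
  GRing.isSubalgClosed.Build R[i] A smooth_pred smooth_pred_closed.

Definition smooth : Type := {x : A | x \in smooth_pred}.

HB.instance Definition _ := SubChoice.on smooth.
HB.instance Definition _ := [SubChoice_isSubAlgebra of smooth by <:].

Lemma smooth_genP i : S i \in smooth_pred.
Proof. by apply/asboolP => P _; apply; exists i. Qed.

Lemma smooth_starP i : star (S i) \in smooth_pred.
Proof.
apply/asboolP => P hP hS; have [_ _ _] := hP; apply.
by apply: hS; exists i.
Qed.

Definition gen i : smooth := exist _ (S i) (smooth_genP i).
Definition gen_star i : smooth := exist _ (star (S i)) (smooth_starP i).

Definition deformation_parameter (k : smooth) : Prop :=
  exists l : smooth, val k * val l = 1 /\ val l * val k = 1.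

Definition torus_action (alpha : ('I_2 -> R[i]) -> A -> A) : Prop :=
  let T2 := [set lambda : 'I_2 -> R[i] | forall j, `|lambda j| = 1] in
  [/\ forall lambda, T2 lambda -> star_hom (alpha lambda),
      forall lambda mu a, T2 lambda -> T2 mu ->
        alpha (fun j => lambda j * mu j) a = alpha lambda (alpha mu a),
      forall a, alpha (fun=> 1) a = a
    & forall lambda j, T2 lambda -> alpha lambda (S j) = lambda j *: S j].

Definition invariant_state (alpha : ('I_2 -> R[i]) -> A -> A) (phi : A -> R[i]) :
    Prop :=
  forall lambda a, (forall j, `|lambda j| = 1) -> phi (alpha lambda a) = phi a.

Definition canonical_derivations (partial : 'I_2 -> smooth -> smooth) : Prop :=
  forall i,
    [/\ forall (c : R[i]) a b,
          partial i (c *: a + b) = c *: partial i a + partial i b,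
        forall a b, partial i (a * b) = partial i a * b + a * partial i b,
        forall j, partial i (gen j) = (i == j)%:R *: gen i
      & forall j, partial i (gen_star j) = - ((i == j)%:R *: gen_star j)].

End Smooth.

(** * Bimodules and their tensor products *)

HB.mixin Record isBimodule (R : nzRingType) V of GRing.Zmodule V := {
  lact : R -> V -> V;
  ract : V -> R -> V;
  lact1 : forall x, lact 1 x = x;
  lactM : forall a b x, lact (a * b) x = lact a (lact b x);
  lactDl : forall a b x, lact (a + b) x = lact a x + lact b x;
  lactDr : forall a x y, lact a (x + y) = lact a x + lact a y;
  ract1 : forall x, ract x 1 = x;
  ractM : forall a b x, ract x (a * b) = ract (ract x a) b;
  ractDr : forall a b x, ract x (a + b) = ract x a + ract x b;
  ractDl : forall a x y, ract (x + y) a = ract x a + ract y a;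
  lractA : forall a b x, ract (lact a x) b = lact a (ract x b)
}.

#[short(type="bimodType")]
HB.structure Definition Bimodule (R : nzRingType) :=
  {V of isBimodule R V & GRing.Zmodule V}.

Section BimodLemmas.
Context {R : nzRingType} {V : bimodType R}.
Lemma lact0 (a : R) : lact a (0 : V) = 0.
Proof. by apply: (addrI (lact a (0 : V))); rewrite -lactDr !addr0. Qed.
Lemma ract0 (a : R) : ract (0 : V) a = 0.
Proof. by apply: (addrI (ract (0 : V) a)); rewrite -ractDl !addr0. Qed.
Lemma lact0r (x : V) : lact (0 : R) x = 0.
Proof. by apply: (addrI (lact (0 : R) x)); rewrite -lactDl !addr0. Qed.
Lemma ract0r (x : V) : ract x (0 : R) = 0.
Proof. by apply: (addrI (ract x (0 : R))); rewrite -ractDr !addr0. Qed.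
Lemma lactN (a : R) (x : V) : lact a (- x) = - lact a x.
Proof. by apply: (addrI (lact a x)); rewrite -lactDr !subrr lact0. Qed.
Lemma ractN (a : R) (x : V) : ract (- x) a = - ract x a.
Proof. by apply: (addrI (ract x a)); rewrite -ractDl !subrr ract0. Qed.
End BimodLemmas.

Section Tensor.
Context {R : nzRingType} (M N : bimodType R).

(* A list of pairs stands for the sum of the corresponding elementary tensors.
   Since [- (m, n)] is [(- m, n)], formal differences are not needed. *)
Inductive tens_eq : seq (M * N) -> seq (M * N) -> Prop :=
| tens_refl s : tens_eq s s
| tens_sym s t : tens_eq s t -> tens_eq t s
| tens_trans s t u : tens_eq s t -> tens_eq t u -> tens_eq s u
| tens_cat s s' t t' : tens_eq s s' -> tens_eq t t' -> tens_eq (s ++ t) (s' ++ t')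
| tens_comm s t : tens_eq (s ++ t) (t ++ s)
| tens_zero n : tens_eq [:: (0, n)] [::]
| tens_addl m m' n : tens_eq [:: (m + m', n)] [:: (m, n); (m', n)]
| tens_addr m n n' : tens_eq [:: (m, n + n')] [:: (m, n); (m, n')]
| tens_bal m a n : tens_eq [:: (ract m a, n)] [:: (m, lact a n)].

Definition tens_rel : rel (seq (M * N)) := fun s t => `[< tens_eq s t >].

Lemma tens_rel_equiv : equiv_class_of tens_rel.
Proof.
split=> [s | s t | t s u].
- by apply/asboolP; exact: tens_refl.
- by apply/asboolP/asboolP; exact: tens_sym.
- by move=> /asboolP h1 /asboolP h2; apply/asboolP; exact: tens_trans h2.
Qed.

Canonical tens_equiv := EquivRelPack tens_rel_equiv.

Definition tens : Type := {eq_quot tens_equiv}.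
HB.instance Definition _ := Choice.on tens.
HB.instance Definition _ := EqQuotient.on tens.

Definition tpi (s : seq (M * N)) : tens := \pi_tens s.

Lemma tpiP s t : tpi s = tpi t <-> tens_eq s t.
Proof. by rewrite /tpi; split=> [/eqmodP/asboolP|h]//; apply/eqmodP/asboolP. Qed.

Lemma tpi_repr t : tpi (repr t) = t.
Proof. exact: reprK. Qed.

Lemma repr_tpi s : tens_eq (repr (tpi s)) s.
Proof. by apply/tpiP; rewrite tpi_repr. Qed.

Definition elem_tens (m : M) (n : N) : tens := tpi [:: (m, n)].

Definition tzero : tens := tpi [::].
Definition tadd (x y : tens) : tens := tpi (repr x ++ repr y).
Definition tmap (f : M -> M) (h : N -> N) (x : tens) : tens :=
  tpi [seq (f p.1, h p.2) | p <- repr x].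
Definition topp : tens -> tens := tmap -%R id.
Definition tlact (a : R) : tens -> tens := tmap (lact a) id.
Definition tract (x : tens) (a : R) : tens := tmap id (ract^~ a) x.

Lemma taddE s t : tadd (tpi s) (tpi t) = tpi (s ++ t).
Proof. by apply/tpiP; apply: tens_cat; exact: repr_tpi. Qed.

Definition tmap_compat (f : M -> M) (h : N -> N) : Prop :=
  [/\ {morph f : x y / x + y}, {morph h : x y / x + y}, f 0 = 0
    & forall m a n, tens_eq [:: (f (ract m a), h n)] [:: (f m, h (lact a n))]].

Lemma tmapE f h s : tmap_compat f h ->
  tmap f h (tpi s) = tpi [seq (f p.1, h p.2) | p <- s].
Proof.
move=> [fD hD f0 fh]; apply/tpiP; have := repr_tpi s; move: (repr _) => t.
elim=> {s t} /=.
- by move=> s; exact: tens_refl.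
- by move=> s t _; exact: tens_sym.
- by move=> s t u _ st _; exact: tens_trans.
- by move=> s s' t t' _ h1 _ h2; rewrite !map_cat; exact: tens_cat.
- by move=> s t; rewrite !map_cat; exact: tens_comm.
- by move=> n; rewrite f0; exact: tens_zero.
- by move=> m m' n; rewrite fD; exact: tens_addl.
- by move=> m n n'; rewrite hD; exact: tens_addr.
- by move=> m a n; exact: fh.
Qed.

Lemma topp_compat : tmap_compat -%R id.
Proof.
split=> //; [by move=> x y; rewrite opprD | exact: oppr0 |].
by move=> m a n; rewrite -ractN; exact: tens_bal.
Qed.

Lemma tlact_compat a : tmap_compat (lact a) id.
Proof.
split=> //; [exact: lactDr | exact: lact0 |].
by move=> m b n; rewrite -lractA; exact: tens_bal.
Qed.

Lemma tract_compat a : tmap_compat id (ract^~ a).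
Proof.
split=> // [x y|m b n]; first exact: ractDl.
by rewrite lractA; exact: tens_bal.
Qed.

Lemma taddA : associative tadd.
Proof.
by move=> x y z; rewrite -[x]tpi_repr -[y]tpi_repr -[z]tpi_repr !taddE catA.
Qed.

Lemma taddC : commutative tadd.
Proof. by move=> x y; apply/tpiP; exact: tens_comm. Qed.

Lemma tadd0 : left_id tzero tadd.
Proof. by move=> x; rewrite -[x]tpi_repr /tzero taddE. Qed.

Lemma taddN : left_inverse tzero topp tadd.
Proof.
move=> x; rewrite -[x]tpi_repr /topp (tmapE _ topp_compat) taddE.
elim: (repr x) => [//|[m n] s /tpiP IH]; apply/tpiP => /=.
apply: (@tens_trans _ (([:: (- m, n)] ++ [:: (m, n)])
                        ++ ([seq (- p.1, p.2) | p <- s] ++ s))).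
  rewrite -cat1s -[in X in tens_eq _ X]catA; apply: tens_cat; first exact: tens_refl.
  rewrite -[(m, n) :: s]cat1s !catA; apply: tens_cat; last exact: tens_refl.
  exact: tens_comm.
apply: (@tens_trans _ ([::] ++ [::])); last exact: tens_refl.
apply: tens_cat => //; apply: tens_trans (tens_zero n).
by apply: tens_sym; rewrite -[0](addNr m); exact: tens_addl.
Qed.

HB.instance Definition _ := GRing.isZmodule.Build tens taddA taddC tadd0 taddN.

Lemma tpi_cat s t : tpi (s ++ t) = tpi s + tpi t.
Proof. by rewrite -taddE. Qed.

Lemma tens_ind (P : tens -> Prop) :
  P 0 -> (forall x y, P x -> P y -> P (x + y)) ->
  (forall m n, P (elem_tens m n)) -> forall t, P t.
Proof.
move=> P0 PD Pe t; rewrite -[t]tpi_repr.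
elim: (repr t) => [|[m n] s IH]; first exact: P0.
by rewrite -cat1s tpi_cat; apply: PD; [exact: Pe | exact: IH].
Qed.

Lemma tmapD f h : tmap_compat f h -> {morph tmap f h : x y / x + y}.
Proof.
move=> fh x y; rewrite -[x]tpi_repr -[y]tpi_repr -tpi_cat !(tmapE _ fh).
by rewrite map_cat tpi_cat.
Qed.

Lemma tmap0 f h : tmap_compat f h -> tmap f h 0 = 0.
Proof. by move=> fh; rewrite -[0]/(tpi [::]) (tmapE _ fh). Qed.

Lemma tmap_elem f h m n : tmap_compat f h ->
  tmap f h (elem_tens m n) = elem_tens (f m) (h n).
Proof. by move=> fh; rewrite /elem_tens (tmapE _ fh). Qed.

Lemma elem_tensDl m m' n : elem_tens (m + m') n = elem_tens m n + elem_tens m' n.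
Proof. by rewrite -tpi_cat; apply/tpiP; exact: tens_addl. Qed.

Lemma elem_tensDr m n n' : elem_tens m (n + n') = elem_tens m n + elem_tens m n'.
Proof. by rewrite -tpi_cat; apply/tpiP; exact: tens_addr. Qed.

Lemma elem_tens_bal m a n : elem_tens (ract m a) n = elem_tens m (lact a n).
Proof. by apply/tpiP; exact: tens_bal. Qed.

Lemma tlact_elem a m n : tlact a (elem_tens m n) = elem_tens (lact a m) n.
Proof. exact: (tmap_elem _ _ (tlact_compat a)). Qed.

Lemma tract_elem a m n : tract (elem_tens m n) a = elem_tens m (ract n a).
Proof. exact: (tmap_elem _ _ (tract_compat a)). Qed.

Lemma tlactDr a x y : tlact a (x + y) = tlact a x + tlact a y.
Proof. exact: (tmapD (tlact_compat a)). Qed.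

Lemma tractDl a x y : tract (x + y) a = tract x a + tract y a.
Proof. exact: (tmapD (tract_compat a)). Qed.

Lemma tlact0 a : tlact a 0 = 0. Proof. exact: (tmap0 (tlact_compat a)). Qed.
Lemma tract0 a : tract 0 a = 0. Proof. exact: (tmap0 (tract_compat a)). Qed.

Lemma tlact1 x : tlact 1 x = x.
Proof.
elim/tens_ind: x => [|x y hx hy|m n]; first exact: tlact0.
  by rewrite tlactDr hx hy.
by rewrite tlact_elem lact1.
Qed.

Lemma tlactM a b x : tlact (a * b) x = tlact a (tlact b x).
Proof.
elim/tens_ind: x => [|x y hx hy|m n]; first by rewrite !tlact0.
  by rewrite !tlactDr hx hy.
by rewrite !tlact_elem lactM.
Qed.

Lemma tlactDl a b x : tlact (a + b) x = tlact a x + tlact b x.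
Proof.
elim/tens_ind: x => [|x y hx hy|m n]; first by rewrite !tlact0 addr0.
  by rewrite !tlactDr hx hy addrACA.
by rewrite !tlact_elem lactDl elem_tensDl.
Qed.

Lemma tract1 x : tract x 1 = x.
Proof.
elim/tens_ind: x => [|x y hx hy|m n]; first exact: tract0.
  by rewrite tractDl hx hy.
by rewrite tract_elem ract1.
Qed.

Lemma tractM a b x : tract x (a * b) = tract (tract x a) b.
Proof.
elim/tens_ind: x => [|x y hx hy|m n]; first by rewrite !tract0.
  by rewrite !tractDl hx hy.
by rewrite !tract_elem ractM.
Qed.

Lemma tractDr a b x : tract x (a + b) = tract x a + tract x b.
Proof.
elim/tens_ind: x => [|x y hx hy|m n]; first by rewrite !tract0 addr0.
  by rewrite !tractDl hx hy addrACA.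
by rewrite !tract_elem ractDr elem_tensDr.
Qed.

Lemma tlractA a b x : tract (tlact a x) b = tlact a (tract x b).
Proof.
elim/tens_ind: x => [|x y hx hy|m n]; first by rewrite !(tract0, tlact0).
  by rewrite !(tractDl, tlactDr) hx hy.
by rewrite !(tract_elem, tlact_elem).
Qed.

HB.instance Definition _ := isBimodule.Build R tens tlact1 tlactM tlactDl tlactDr
  tract1 tractM tractDr tractDl tlractA.

(* The additive map determined by [m (x) n |-> f m n]. The choice of
   representative is irrelevant when [f] is balanced, by [tlift_elem] and
   [tliftD] below. *)
Definition tlift (G : zmodType) (f : M -> N -> G) (t : tens) : G :=
  \sum_(p <- repr t) f p.1 p.2.

Definition tens_balanced (G : zmodType) (f : M -> N -> G) : Prop :=
  [/\ forall m m' n, f (m + m') n = f m n + f m' n,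
      forall m n n', f m (n + n') = f m n + f m n'
    & forall m a n, f (ract m a) n = f m (lact a n)].

Lemma tlift_tpi (G : zmodType) (f : M -> N -> G) s : tens_balanced f ->
  tlift f (tpi s) = \sum_(p <- s) f p.1 p.2.
Proof.
move=> [fDl fDr fb]; rewrite /tlift.
have := repr_tpi s; move: (repr _) => t.
elim=> {s t} //=.
- by move=> s t u _ -> _ ->.
- by move=> s s' t t' _ e1 _ e2; rewrite !big_cat /= e1 e2.
- by move=> s t; rewrite !big_cat /= addrC.
- move=> n; rewrite big_seq1 big_nil /=.
  by apply: (addrI (f 0 n)); rewrite -fDl !addr0.
- by move=> m m' n; rewrite !big_cons !big_nil !addr0 /= fDl.
- by move=> m n n'; rewrite !big_cons !big_nil !addr0 /= fDr.
- by move=> m a n; rewrite !big_seq1 /= fb.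
Qed.

Lemma tlift_elem (G : zmodType) (f : M -> N -> G) m n : tens_balanced f ->
  tlift f (elem_tens m n) = f m n.
Proof. by move=> hf; rewrite tlift_tpi // big_seq1. Qed.

Lemma tliftD (G : zmodType) (f : M -> N -> G) : tens_balanced f ->
  {morph tlift f : x y / x + y}.
Proof.
move=> hf x y; rewrite -[x]tpi_repr -[y]tpi_repr -tpi_cat !tlift_tpi //.
by rewrite big_cat.
Qed.

End Tensor.

Notation "m \ot n" := (elem_tens m n) (at level 40, left associativity).

Section TensorMaps.
Context {R : nzRingType}.

Definition tens_assoc (M N P : bimodType R) (t : tens (tens M N) P) :
    tens M (tens N P) :=
  tlift (fun mn p => tlift (fun m n => m \ot (n \ot p)) mn) t.

Definition tens_assoc_inv (M N P : bimodType R) (t : tens M (tens N P)) :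
    tens (tens M N) P :=
  tlift (fun m np => tlift (fun n p => (m \ot n) \ot p) np) t.

Definition id_tens (M N N' : bimodType R) (f : N -> N') (t : tens M N) : tens M N' :=
  tlift (fun m n => m \ot f n) t.

(* [g (x) id], followed by the identification of [R (x) N] with [N]. *)
Definition contract (M N : bimodType R) (g : M -> R) (t : tens M N) : N :=
  tlift (fun m n => lact (g m) n) t.

Definition central_elt (M : bimodType R) (x : M) : Prop :=
  forall a : R, lact a x = ract x a.

Definition bimodule_map (M N : bimodType R) (f : M -> N) : Prop :=
  [/\ {morph f : x y / x + y},
      forall a x, f (lact a x) = lact a (f x)
    & forall x a, f (ract x a) = ract (f x) a].

Definition right_linear (M N : bimodType R) (f : M -> N) : Prop :=
  {morph f : x y / x + y} /\ forall x a, f (ract x a) = ract (f x) a.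

Definition right_functional (M : bimodType R) (f : M -> R) : Prop :=
  {morph f : x y / x + y} /\ forall x a, f (ract x a) = f x * a.

End TensorMaps.

(** * Differential calculi *)

(* A differential graded algebra is encoded by its total algebra, [deg n] being
   the subspace of homogeneous elements of degree [n]; the product of [carrier]
   is the wedge product, and [alg_incl] identifies [B] with the degree zero part. *)
Record calculus (C : fieldType) (B : algType C) := Calculus {
  carrier : algType C;
  deg : nat -> {pred carrier};
  deg0P : forall n, 0 \in deg n;
  deg_linear : forall n (c : C) x y,
    x \in deg n -> y \in deg n -> c *: x + y \in deg n;
  deg_mul : forall m n x y, x \in deg m -> y \in deg n -> x * y \in deg (m + n)%N;
  deg_total : forall x : carrier, exists n (f : nat -> carrier),
    (forall i, f i \in deg i) /\ x = \sum_(i < n) f i;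
  deg_direct : forall n (f : nat -> carrier), (forall i, f i \in deg i) ->
    \sum_(i < n) f i = 0 -> forall i, (i < n)%N -> f i = 0;
  alg_incl : {lrmorphism B -> carrier};
  alg_incl_inj : injective alg_incl;
  alg_incl_deg : forall x, x \in deg 0 <-> exists b, x = alg_incl b;
  dga_d : {linear carrier -> carrier};
  dga_d_deg : forall n x, x \in deg n -> dga_d x \in deg n.+1;
  dga_dM : forall n x y, x \in deg n ->
    dga_d (x * y) = dga_d x * y + (-1) ^+ n * (x * dga_d y);
  dga_dd : forall x, dga_d (dga_d x) = 0;
  generated : forall n x, x \in deg n -> exists s : seq (B * n.-tuple B),
    x = \sum_(p <- s) alg_incl p.1 * \prod_(b <- p.2) dga_d (alg_incl b)
}.

Arguments carrier {C B} Om : rename.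
Arguments deg {C B} Om n : rename.
Arguments alg_incl {C B} Om : rename.
Arguments dga_d {C B} Om : rename.

Section Forms.
Context {C : fieldType} {B : algType C} (Om : calculus B).

Lemma deg_zmod_closed n : zmod_closed (deg Om n).
Proof.
split; first exact: deg0P.
by move=> x y hx hy; rewrite addrC -scaleN1r; exact: deg_linear.
Qed.

HB.instance Definition _ n :=
  GRing.isZmodClosed.Build (carrier Om) (deg Om n) (deg_zmod_closed n).

Definition Omega (n : nat) : Type := {x : carrier Om | x \in deg Om n}.

HB.instance Definition _ n := SubChoice.on (Omega n).
HB.instance Definition _ n := [SubChoice_isSubZmodule of Omega n by <:].

Lemma form_lactP n b (x : Omega n) : alg_incl Om b * val x \in deg Om n.
Proof.
have h : alg_incl Om b \in deg Om 0 by apply/alg_incl_deg; exists b.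
exact: deg_mul h (valP x).
Qed.

Lemma form_ractP n (x : Omega n) b : val x * alg_incl Om b \in deg Om n.
Proof.
have h : alg_incl Om b \in deg Om 0 by apply/alg_incl_deg; exists b.
by have := deg_mul (valP x) h; rewrite addn0.
Qed.

Definition form_lact n b (x : Omega n) : Omega n :=
  exist _ (alg_incl Om b * val x) (form_lactP b x).
Definition form_ract n (x : Omega n) b : Omega n :=
  exist _ (val x * alg_incl Om b) (form_ractP x b).

Section Instance.
Variable n : nat.
Implicit Types (a b : B) (x y : Omega n).
Let l1 x : form_lact 1 x = x.
Proof. by apply: val_inj; rewrite /= rmorph1 mul1r. Qed.
Let lM a b x : form_lact (a * b) x = form_lact a (form_lact b x).
Proof. by apply: val_inj; rewrite /= rmorphM mulrA. Qed.
Let lDl a b x : form_lact (a + b) x = form_lact a x + form_lact b x.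
Proof. by apply: val_inj; rewrite /= rmorphD mulrDl. Qed.
Let lDr a x y : form_lact a (x + y) = form_lact a x + form_lact a y.
Proof. by apply: val_inj; rewrite /= mulrDr. Qed.
Let r1 x : form_ract x 1 = x.
Proof. by apply: val_inj; rewrite /= rmorph1 mulr1. Qed.
Let rM a b x : form_ract x (a * b) = form_ract (form_ract x a) b.
Proof. by apply: val_inj; rewrite /= rmorphM mulrA. Qed.
Let rDr a b x : form_ract x (a + b) = form_ract x a + form_ract x b.
Proof. by apply: val_inj; rewrite /= rmorphD mulrDr. Qed.
Let rDl a x y : form_ract (x + y) a = form_ract x a + form_ract y a.
Proof. by apply: val_inj; rewrite /= mulrDl. Qed.
Let lrA a b x : form_ract (form_lact a x) b = form_lact a (form_ract x b).
Proof. by apply: val_inj; rewrite /= mulrA. Qed.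
HB.instance Definition _ :=
  isBimodule.Build B (Omega n) l1 lM lDl lDr r1 rM rDr rDl lrA.
End Instance.

Lemma d0P b : dga_d Om (alg_incl Om b) \in deg Om 1.
Proof. by apply: dga_d_deg; apply/alg_incl_deg; exists b. Qed.

Definition d0 (b : B) : Omega 1 := exist _ (dga_d Om (alg_incl Om b)) (d0P b).

Lemma wedgeP (x y : Omega 1) : val x * val y \in deg Om 2.
Proof. exact: (deg_mul (valP x) (valP y)). Qed.

Definition wedge1 (x y : Omega 1) : Omega 2 := exist _ (val x * val y) (wedgeP x y).

Lemma d1P (x : Omega 1) : dga_d Om (val x) \in deg Om 2.
Proof. exact: dga_d_deg (valP x). Qed.

Definition d1 (x : Omega 1) : Omega 2 := exist _ (dga_d Om (val x)) (d1P x).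

Local Notation Om1 := (Omega 1).
Local Notation Om1Om1 := (tens (Omega 1) (Omega 1)).

Definition wedge_map : Om1Om1 -> Omega 2 := tlift wedge1.

(* [P] is the idempotent with range [Ker wedge_map] and kernel [F] of the tame
   calculus [Om]; the last clause is the condition on [sigma = 2 P - 1]. *)
Definition tame_Psym (P : Om1Om1 -> Om1Om1) : Prop :=
  [/\ bimodule_map P,
      forall t, P (P t) = P t,
      forall t, (exists u, t = P u) <-> wedge_map t = 0,
      exists phi : Om1Om1 -> Omega 2,
        [/\ right_linear phi,
            forall t, P t = 0 -> phi t = 0 -> t = 0
          & forall w, exists2 t, P t = 0 & phi t = w]
    & forall w h : Om1, central_elt w -> central_elt h ->
        P (w \ot h) *+ 2 - w \ot h = h \ot w].

Definition sigma (P : Om1Om1 -> Om1Om1) (t : Om1Om1) : Om1Om1 := P t *+ 2 - t.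

Definition sigma23 (P : Om1Om1 -> Om1Om1) (t : tens Om1Om1 Om1) : tens Om1Om1 Om1 :=
  tens_assoc_inv (id_tens (sigma P) (tens_assoc t)).

Definition connection (nabla : Om1 -> Om1Om1) : Prop :=
  [/\ {morph nabla : x y / x + y},
      forall (c : C) x, nabla (lact (c%:A) x) = lact (c%:A) (nabla x)
    & forall x b, nabla (ract x b) = ract (nabla x) b + x \ot d0 b].

Definition is_Pi (P : Om1Om1 -> Om1Om1) (g : Om1Om1 -> B) (nabla : Om1 -> Om1Om1)
    (Pi : Om1Om1 -> Om1) : Prop :=
  {morph Pi : x y / x + y} /\
  forall (w h : Om1) (b : B), central_elt w -> central_elt h ->
    Pi (w \ot ract h b) =
      ract (contract g (sigma23 P (nabla w \ot h + nabla h \ot w))) b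
      + lact (g (w \ot h)) (d0 b).

Definition levi_civita (P : Om1Om1 -> Om1Om1) (g : Om1Om1 -> B)
    (nabla : Om1 -> Om1Om1) : Prop :=
  [/\ connection nabla,
      forall x, wedge_map (nabla x) + d1 x = 0
    & is_Pi P g nabla (fun t => d0 (g t))].

Definition christoffel (e : 'I_2 -> Om1) (nabla : Om1 -> Om1Om1)
    (Gamma : 'I_2 -> 'I_2 -> 'I_2 -> B) : Prop :=
  forall i, nabla (e i) = \sum_j \sum_l ract (e j \ot e l) (Gamma i j l).

(* The metric [k g0]. *)
Definition conformal_metric (e : 'I_2 -> Om1) (k : B) (g : Om1Om1 -> B) : Prop :=
  right_functional g /\
  forall a : 'I_2 -> 'I_2 -> B,
    g (\sum_i \sum_j e i \ot ract (e j) (a i j)) = \sum_i k * a i i.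

Definition curvature12 (partial : 'I_2 -> B -> B) (e : 'I_2 -> Om1)
    (Gamma : 'I_2 -> 'I_2 -> 'I_2 -> B) : Omega 2 :=
  let i1 : 'I_2 := ord0 in
  let i2 : 'I_2 := ord_max in
  ract (wedge1 (e i1) (e i2))
    (\sum_p (Gamma p i2 i1 * Gamma i1 p i2 - Gamma p i2 i2 * Gamma i1 p i1)
     - partial i2 (Gamma i1 i2 i1) + partial i1 (Gamma i1 i2 i2)).

(* [integral_form phi e theta] is [phi a] when [theta = e_1 /\ e_2 a]. *)
Definition integral_form (phi : B -> C) (e : 'I_2 -> Om1) (theta : Omega 2) : C :=
  phi (xget 0 [set a | theta = ract (wedge1 (e ord0) (e ord_max)) a]).

End Forms.

(** * Connes' calculus of [D = partial_1 (x) gamma_1 + partial_2 (x) gamma_2] *)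

Section Connes.
Context {R : realType} {A : cstarType R} (S : 'I_2 -> A).
Context {H : hilbertType R} (pi : A -> H -> H) (xi : H).
Context (gamma : 'I_2 -> 'M[R[i]]_2) (partial : 'I_2 -> smooth S -> smooth S).

Definition clifford : Prop :=
  (forall i, gamma i *m gamma i = 1%:M) /\
  gamma ord0 *m gamma ord_max = - (gamma ord_max *m gamma ord0).

(* [H * H] is [L^2(A) (x) C^2], the two components being the coordinates in the
   canonical basis of [C^2]. *)

Definition spinor_mx (c : 'M[R[i]]_2) (v : H * H) : H * H :=
  (c ord0 ord0 *: v.1 + c ord0 ord_max *: v.2,
   c ord_max ord0 *: v.1 + c ord_max ord_max *: v.2).

Definition spinor_mul (a : smooth S) (v : H * H) : H * H :=
  (pi (val a) v.1, pi (val a) v.2).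

(* The element of the domain of [D] given by a pair of smooth elements. *)
Definition spinor (b : smooth S * smooth S) : H * H :=
  (pi (val b.1) xi, pi (val b.2) xi).

Definition dirac_op (b : smooth S * smooth S) : H * H :=
  \sum_i spinor_mx (gamma i) (spinor (partial i b.1, partial i b.2)).

(* [T] is the bounded extension of the commutator [[D, a]]. *)
Definition is_dirac_comm (a : smooth S) (T : H * H -> H * H) : Prop :=
  [/\ forall (c : R[i]) v w, T (c *: v + w) = c *: T v + T w,
      continuous T
    & forall b, T (spinor b) = dirac_op (a * b.1, a * b.2) - spinor_mul a (dirac_op b)].

Definition dirac_comm (a : smooth S) : H * H -> H * H :=
  xget (fun=> 0) [set T | is_dirac_comm a T].

(* Universal forms are represented by formal sums of [a_0 d a_1 ... d a_n].
   [upi] and [udelta] respect the relations between such sums in the reduced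
   universal algebra, so the set [junk n = Pi (delta J_0^(n-1))] may be
   computed with representatives. *)
Definition uform (n : nat) : Type := seq (smooth S * n.-tuple (smooth S)).

Definition upi n (s : uform n) (v : H * H) : H * H :=
  \sum_(p <- s) spinor_mul p.1 (foldr (fun a w => dirac_comm a w) v p.2).

Definition udelta n (s : uform n) : uform n.+1 :=
  [seq (1, cons_tuple p.1 p.2) | p <- s].

Definition junk (n : nat) : set (H * H -> H * H) :=
  match n with
  | 0 => [set fun=> 0]
  | m.+1 => [set upi (udelta s) | s in [set s : uform m | upi s = fun=> 0]]
  end.

Variable Om : calculus (smooth S).

Definition ueval n (s : uform n) : carrier Om :=
  \sum_(p <- s) alg_incl Om p.1 * \prod_(b <- p.2) dga_d Om (alg_incl Om b).

(* Up to isomorphism, [Om^n] is [Pi (Omega_u^n) / Pi (delta J_0^(n-1))]: as [Om]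
   is generated in degree zero it is a quotient of the universal algebra, and
   the kernel of the quotient map is prescribed. *)
Definition connes_calculus : Prop :=
  forall n (s : uform n), ueval s = 0 <-> junk n (upi s).

(* [e i] is the one-form represented by the operator [1 (x) gamma_i]. *)
Definition canonical_frame (e : 'I_2 -> Omega Om 1) : Prop :=
  forall i, exists s : uform 1,
    val (e i) = ueval s /\ upi s = spinor_mx (gamma i).

End Connes.

(* Main.v *)
(* In the frame [e_1, e_2] the metric [k g_0] has components [k delta_ij]. With
   [K_l = k^-1 (partial_l k) / 2], the torsion-free metric connection has
   Christoffel symbols [Gamma^i_jl = delta_ij K_l + delta_il K_j - delta_jl
     K_i],
   exactly as for a conformally flat metric in the commutative case; [K_1] and
   [K_2] need not commute, but the quadratic terms of the curvature cancel
     anyway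
   and leave [- partial_1 K_1 - partial_2 K_2].
     The trace vanishes on the range of
   [partial_i]: both are diagonal on homogeneous elements, and [tau] kills those
   of nonzero degree by invariance. Hence the integral is always [0].

   The frame is central, free and closed by computing with the operators that
   represent forms. This uses [[D, a] = sum_i (partial_i a) (x) gamma_i] on the
   whole Hilbert space, hence the density of the smooth vectors, hence the norm
   continuity of states: [1 - h] is a square when [h] is small and self-adjoint.
   The junk in degree one is [0] and in degree two it is [A (x) 1]. *)

Require Import Defs.
From HB Require Import structures.
From mathcomp Require Import all_boot all_order all_algebra.
From mathcomp Require Import generic_quotient complex.
From mathcomp Require Import ring lra.
From mathcomp Require Import all_classical all_reals all_analysis.
Import numFieldNormedType.Exports.
Import Order.TTheory GRing.Theory Num.Theory.
Local Open Scope classical_set_scope.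
Local Open Scope ring_scope.

(** * Positive functionals on a C*-algebra *)

Section CStarFacts.
Context {R : realType} {A : cstarType R}.
Implicit Types (x y h : A) (phi : A -> R[i]).

Lemma cnorm0 : cnorm (0 : A) = 0.
Proof.
have := cnormZ (0 : R[i]) (0 : A).
by rewrite scale0r normr0 mul0r => -[].
Qed.

Lemma cnormN x : cnorm (- x) = cnorm x.
Proof.
by have := cnormZ (-1 : R[i]) x; rewrite scaleN1r normrN1 mul1r => -[].
Qed.

Lemma cnorm_ge0 x : 0 <= cnorm x.
Proof. by have := cnormD x (- x); rewrite subrr cnorm0 cnormN; lra. Qed.

Lemma cnormZr (c : R) x : cnorm (c%:C%C *: x) = `|c| * cnorm x.
Proof.
have := cnormZ (c%:C%C) x.
by rewrite normc_def /= expr0n /= addr0 sqrtr_sqr -rmorphM => -[].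
Qed.

Lemma star0 : star (0 : A) = 0.
Proof.
by have := starZ (0 : R[i]) (0 : A); rewrite !scale0r rmorph0 scale0r.
Qed.

Lemma starN x : star (- x) = - star x.
Proof. by rewrite -scaleN1r starZ rmorphN1 scaleN1r. Qed.

Lemma star1 : star (1 : A) = 1.
Proof. by rewrite -[LHS]mul1r -[X in X * _](starK 1) -starM mul1r starK. Qed.

(** The C*-identity and submultiplicativity bound $\|z\|^2 = \|z^* z\|$ by $\|z^*\| \|z\|$; the
    reverse inequality is the same bound for the adjoint of $z$. *)
Lemma cnorm_starE x : cnorm (star x) = cnorm x.
Proof.
have le (z : A) : cnorm z <= cnorm (star z).
  have := cnorm_star z; have := cnormM (star z) z; have := cnorm_ge0 z.
  rewrite le_eqVlt => /orP[/eqP <- //= | z0 h1 h2]; first by rewrite cnorm_ge0.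
  by move: h1; rewrite h2 expr2 ler_pM2r.
by apply/eqP; rewrite eq_le le andbT; have := le (star x); rewrite starK.
Qed.

Lemma cnorm_small0 (x : A) (M : R) :
  (forall eps, 0 < eps -> cnorm x <= M * eps) -> x = 0.
Proof.
move=> h; apply: cnorm_eq0; apply/eqP; rewrite eq_le cnorm_ge0 andbT.
rewrite leNgt; apply/negP => x0.
have M0 : 0 < M by have := h 1 ltr01; rewrite mulr1; exact: lt_le_trans.
have := h (cnorm x / (2 * M)).
rewrite divr_gt0 ?mulr_gt0 // => /(_ isT).
have -> : M * (cnorm x / (2 * M)) = cnorm x / 2 by field; rewrite gt_eqF.
by lra.
Qed.

Lemma cnorm_sqrB x y (r : R) : cnorm x <= r -> cnorm y <= r ->
  cnorm (x * x - y * y) <= (2 * r) * cnorm (x - y).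
Proof.
move=> hx hy; have -> : x * x - y * y = x * (x - y) + (x - y) * y.
  by rewrite mulrBr mulrBl addrA subrK.
apply: le_trans (cnormD _ _) _; have := cnorm_ge0 (x - y) => d0.
rewrite -mulrA mulr_natl mulr2n; apply: lerD.
  by apply: le_trans (cnormM _ _) _; rewrite ler_wpM2r.
by apply: le_trans (cnormM _ _) _; rewrite mulrC ler_wpM2r.
Qed.

(* [1 - y] is a square root of [1 - h] as soon as [y = (h + y ^ 2) / 2]; the
   right-hand side is a contraction of the ball of radius [1 / 2]. *)
Lemma one_sub_small_is_square h : star h = h -> cnorm h <= 2^-1 ->
  exists y, star y * y = 1 - h.
Proof.
move=> hs hn.
pose c : R[i] := (2^-1 : R)%:C%C.
have cE (z : A) : cnorm (c *: z) = 2^-1 * cnorm z.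
  by rewrite /c cnormZr ger0_norm ?invr_ge0.
have c2 (z : A) : c *: z + c *: z = z.
  rewrite -scalerDl -rmorphD; have -> : (2^-1 + 2^-1 : R) = 1 by lra.
  by rewrite scale1r.
pose y n := iter n (fun z : A => c *: (h + z * z)) 0.
have yS n : y n.+1 = c *: (h + y n * y n) by [].
have yn n : cnorm (y n) <= 2^-1.
  elim: n => [|n IH]; first by rewrite cnorm0 invr_ge0.
  rewrite yS cE; have := cnormD h (y n * y n); have := cnormM (y n) (y n).
  have := cnorm_ge0 (y n); nra.
have ys n : star (y n) = y n.
  elim: n => [|n IH]; first exact: star0.
  by rewrite yS starZ starD hs starM IH geC0_conj // lecR invr_ge0.
(* On the ball of radius $1/2$ squaring is 1-Lipschitz, so the scalar [c] gives contraction by $1/2$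
   at each iteration. *)
have yB n p : cnorm (y (p + n)%N - y n) <= 2^-1 ^+ n.
  elim: n => [|n IH]; first by rewrite subr0 expr0 (le_trans (yn _)) //; lra.
  rewrite addnS !yS -scalerBr cE opprD addrACA subrr add0r exprS ler_wpM2l
    ?invr_ge0 //.
  apply: le_trans IH; have := cnorm_sqrB _ _ _ (yn (p + n)%N) (yn n).
  by rewrite divff ?mul1r // pnatr_eq0.
have [l yl] : exists l, forall eps : R, 0 < eps -> exists N, forall n,
      (N <= n)%N -> cnorm (y n - l) < eps.
  apply: cnorm_complete => eps e0.
  have [N hN] : exists N, 2^-1 ^+ N < eps / 2 :> R.
    have := @cvg_expr R 2^-1; rewrite ger0_norm ?invr_ge0 // => /(_ ltac:(lra)).
    move/cvgrPdist_lt => /(_ (eps / 2)).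
    rewrite divr_gt0 // => /(_ isT)[N _ /(_ N)] /=.
    rewrite leqnn => /(_ isT).
    rewrite sub0r normrN normrX ger0_norm ?invr_ge0 // => ?.
    by exists N.
  exists N => m n /subnK <- /subnK <-.
  have -> : y (m - N + N)%N - y (n - N + N)%N
    = (y (m - N + N)%N - y N) - (y (n - N + N)%N - y N)
      by rewrite opprB addrA subrK.
  apply: le_lt_trans (cnormD _ _) _; rewrite cnormN.
  have := yB N (m - N)%N; have := yB N (n - N)%N; lra.
have lE : l + l = h + l * l.
  apply/eqP; rewrite -subr_eq0; apply/eqP.
  (* Since $2 y_{N+1} = h + y_N^2$, the defect is $(y_N^2 - l^2) + 2 (l - y_{N+1})$. The second term
     accounts for the constant 2, and the rest is the Lipschitz constant of squaring on a ball of
     radius $1/2 + \|l\|$, which contains both $y_N$ and $l$. *)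
  apply: (@cnorm_small0 _ (2 + 2 * (2^-1 + cnorm l))) => eps e0.
  have [N hN] := yl _ e0.
  have -> : l + l - (h + l * l)
      = (y N * y N - l * l) + ((l - y N.+1) + (l - y N.+1)).
    rewrite [l - _ + _]addrACA -opprD yS c2.
    by rewrite [RHS]addrC !opprD -!addrA addKr.
  apply: le_trans (cnormD _ _) _; apply: le_trans (lerD _ (cnormD _ _)) _.
    apply: (cnorm_sqrB _ _ (2^-1 + cnorm l)); last by rewrite lerDr invr_ge0.
    by apply: le_trans (yn N) _; rewrite lerDl cnorm_ge0.
  have := hN N (leqnn N); have := hN N.+1 (leqnSn N).
  rewrite -[cnorm (y N.+1 - l)]cnormN opprB.
  have := cnorm_ge0 l; have := cnorm_ge0 (y N - l); nra.
have ls : star l = l.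
  apply/eqP; rewrite -subr_eq0; apply/eqP.
  apply: (@cnorm_small0 _ 2) => eps e0; have [N hN] := yl _ e0.
  have -> : star l - l = (y N - l) - star (y N - l).
    by rewrite starD starN ys opprB [RHS]addrC addrA subrK.
  apply: le_trans (cnormD _ _) _; rewrite cnormN cnorm_starE.
  have := hN N (leqnn N); lra.
exists (1 - l).
rewrite starD starN star1 ls mulrBr mulr1 mulrBl mul1r -[h](addrK (l * l)) -lE.
by rewrite !opprD !addrA !opprK.
Qed.

Lemma stateZ phi c x : state phi -> phi (c *: x) = c * phi x.
Proof.
move=> [hl _ _]; have h0 : phi 0 = 0.
  by apply: (addrI (phi 0)); have := hl 1 0 0;
    rewrite scale1r addr0 mul1r addr0.
by have := hl c x 0; rewrite !addr0 h0 addr0.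
Qed.

Lemma stateD phi x y : state phi -> phi (x + y) = phi x + phi y.
Proof. by move=> [hl _ _]; have := hl 1 x y; rewrite scale1r mul1r. Qed.

(** With $c = 1 / (2 \|x\|^2)$ the self-adjoint element $c x^* x$ has norm $1/2$, so $1 - c x^* x$
    has the form $y^* y$, and positivity gives $c \phi(x^* x) \le 1$. The bound serves only for
    continuity, so the factor 2 is harmless. *)
Lemma state_bounded phi x : state phi ->
  phi (star x * x) <= (2 * cnorm x ^+ 2)%:C%C.
Proof.
move=> hphi; have [_ phi_ge0 phi1] := hphi.
have [x0|] := eqVneq (cnorm x) 0.
  by rewrite (cnorm_eq0 x x0) cnorm0 mulr0 -(scale0r 0) stateZ // mul0r expr0n
    mulr0.
rewrite neq_lt ltNge cnorm_ge0 /= => x0.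
pose c : R := (2 * cnorm x ^+ 2)^-1.
have cx : 0 < 2 * cnorm x ^+ 2 by rewrite mulr_gt0 ?exprn_gt0.
have c0 : 0 < c by rewrite invr_gt0.
have [||y hy] := one_sub_small_is_square (c%:C%C *: (star x * x)).
- by rewrite starZ starM starK geC0_conj // lecR ltW.
- rewrite cnormZr cnorm_star (ger0_norm (ltW c0)) /c.
  rewrite invfM -mulrA mulVf ?mulr1 //.
  by rewrite gt_eqF ?exprn_gt0.
have := phi_ge0 y; rewrite hy stateD // -scaleN1r !stateZ // phi1 mulN1r
  subr_ge0.
have /=-> : 2 * cnorm x ^+ 2 = c^-1 by rewrite invrK.
have -> : (c^-1)%:C%C = c%:C%C^-1 by exact: fmorphV.
by rewrite -[X in _ -> _ <= X]mulr1 ler_pdivlMl // ltcR.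
Qed.
End CStarFacts.

(** * Generation and unitarity of the canonical generators *)

Section FreeGeneration.
Context {I : Type} {F : groupType} {s : I -> F} (K : {pred F}).
Hypotheses (free_s : free_group_on s) (K_group : group_closed K).
Hypothesis (sK : forall i, s i \in K).

Definition subgroup : Type := {x : F | x \in K}.
HB.instance Definition _ := SubChoice.on subgroup.
HB.instance Definition _ := SubChoice_isSubGroup.Build F K subgroup K_group.

(* The universal map onto the subgroup, followed by the inclusion, is the
   identity by uniqueness. *)
Lemma free_group_generated g : g \in K.
Proof.
have [f [[fM fs] _]] := free_s subgroup (fun i => exist _ (s i) (sK i)).
have [f' [_ uniq_f']] := free_s F s.
have e1 : f' = (fun x => \val (f x)).
  apply: uniq_f'; split=> [x y|i]; first by rewrite fM valM.
  by rewrite fs.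
have e2 : f' = id by apply: uniq_f'; split.
have -> : g = \val (f g) by rewrite -[LHS]/(id g) -e2 e1.
exact: valP.
Qed.
End FreeGeneration.

(** * Inner products, orthonormal bases and *-representations *)

Section HilbertFacts.
Context {R : realType} {H : hilbertType R}.
Implicit Types (v w : H).

Lemma dot0r v : dot v 0 = 0.
Proof. by have := dotZr 0 v 0; rewrite scale0r mul0r. Qed.

Lemma dotBr v w w' : dot v (w - w') = dot v w - dot v w'.
Proof. by rewrite -scaleN1r dotDr dotZr mulN1r. Qed.

Lemma onb_ext {I : eqType} {b : I -> H} v w : orthonormal_basis b ->
  (forall i, dot (b i) v = dot (b i) w) -> v = w.
Proof.
move=> [_ hb] h; apply/eqP; rewrite -subr_eq0; apply/eqP; apply: hb => i.
by rewrite dotBr h subrr.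
Qed.
End HilbertFacts.

Section StarRep.
Context {R : realType} {A : cstarType R} {H : hilbertType R}.
Context {rho : A -> H -> H}.
Hypothesis rho_rep : star_rep rho.

Lemma rep_lin a (c : R[i]) v w : rho a (c *: v + w) = c *: rho a v + rho a w.
Proof. by have [h _ _ _ _] := rho_rep. Qed.
Lemma repDr a v w : rho a (v + w) = rho a v + rho a w.
Proof. by have := rep_lin a 1 v w; rewrite !scale1r. Qed.
Lemma rep0r a : rho a 0 = 0.
Proof. by apply: (addrI (rho a 0)); rewrite -repDr !addr0. Qed.
Lemma repZr a (c : R[i]) v : rho a (c *: v) = c *: rho a v.
Proof. by have := rep_lin a c v 0; rewrite rep0r !addr0. Qed.
Lemma repNr a v : rho a (- v) = - rho a v.
Proof. by rewrite -scaleN1r repZr scaleN1r. Qed.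
Lemma rep_linl (c : R[i]) a b v : rho (c *: a + b) v = c *: rho a v + rho b v.
Proof. by have [_ _ h _ _] := rho_rep. Qed.
Lemma repDl a b v : rho (a + b) v = rho a v + rho b v.
Proof. by have := rep_linl 1 a b v; rewrite !scale1r. Qed.
Lemma rep0l v : rho 0 v = 0.
Proof. by apply: (addrI (rho 0 v)); rewrite -repDl !addr0. Qed.
Lemma repZl (c : R[i]) a v : rho (c *: a) v = c *: rho a v.
Proof. by have := rep_linl c a 0 v; rewrite rep0l !addr0. Qed.
Lemma repNl a v : rho (- a) v = - rho a v.
Proof. by rewrite -scaleN1r repZl scaleN1r. Qed.
Lemma repM a b v : rho (a * b) v = rho a (rho b v).
Proof. by have [_ _ _ [h _] _] := rho_rep. Qed.
Lemma rep1 v : rho 1 v = v.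
Proof. by have [_ _ _ [_ h] _] := rho_rep. Qed.
Lemma rep_adj a v w : dot (rho a v) w = dot v (rho (star a) w).
Proof. by have [_ _ _ _ h] := rho_rep. Qed.
Lemma rep_cont a : continuous (rho a).
Proof. by have [_ h _ _ _] := rho_rep. Qed.

End StarRep.

(** * The left regular representation of a group *)

Section ReducedGroup.
Context {R : realType} {G : groupType} {A : cstarType R} {u : G -> A}.
Context {H : hilbertType R} {lambda : A -> H -> H} {delta : G -> H}.
Hypotheses (rep : star_rep lambda).
Hypotheses (faithful : forall a, (forall v, lambda a v = 0) -> a = 0).
Hypotheses (onb : orthonormal_basis delta).
Hypothesis regular : forall g h, lambda (u g) (delta h) = delta (g * h)%g.

(** Faithfulness asks for vanishing on every vector, while [delta] is complete only in the sense
    that its orthogonal complement is trivial. Two passages to the adjoint bridge this: if [a - b]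
    kills the basis, so does its adjoint, and then [a - b] sends every vector into the orthogonal
    complement of the basis. *)
Lemma regular_ext a b :
  (forall k, lambda a (delta k) = lambda b (delta k)) -> a = b.
Proof.
move=> ab; apply/eqP; rewrite -subr_eq0; apply/eqP; apply: faithful => v.
have z k : lambda (a - b) (delta k) = 0.
  by rewrite (repDl rep) (repNl rep) ab subrr.
have zs k : lambda (star (a - b)) (delta k) = 0.
  apply: (onb_ext _ _ onb) => j.
  by rewrite -(rep_adj rep) z (dotC (delta k)) !dot0r rmorph0.
apply: (onb_ext _ _ onb) => j.
by rewrite -[a - b]starK -(rep_adj rep) zs (dotC v) !dot0r rmorph0.
Qed.

Lemma regular_mul g h : u (g * h)%g = u g * u h.
Proof. by apply: regular_ext => k; rewrite (repM rep) !regular mulgA. Qed.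

Lemma regular_one : u 1%g = 1.
Proof. by apply: regular_ext => k; rewrite (rep1 rep) regular mul1g. Qed.

(** The matrix coefficients of both sides at [j], [k] are 1 exactly when $g j = k$, and 0
    otherwise. *)
Lemma regular_star g : star (u g) = u g^-1%g.
Proof.
apply: regular_ext => k; apply: (onb_ext _ _ onb) => j.
rewrite -(rep_adj rep) !regular; have [onE _] := onb; rewrite !onE.
by congr (_%:R); congr nat_of_bool; apply/eqP/eqP => [<-|->];
  rewrite ?mulKg ?mulVKg.
Qed.

Lemma regular_unitary g : unitary (u g).
Proof.
by split; rewrite regular_star -regular_mul ?mulVg ?mulgV regular_one.
Qed.
End ReducedGroup.

(** * Density of the *-algebra generated by the canonical unitaries *)

Section SmoothGeneration.
Context {R : realType} {A : cstarType R}.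

Lemma star_gen_subalg (X : set A) : star_subalg (star_gen X).
Proof.
split=> [P [] //|c x y hx hy P hP XP|x y hx hy P hP XP|x hx P hP XP].
- by have [_ h _ _] := hP; apply: h; [exact: hx | exact: hy].
- by have [_ _ h _] := hP; apply: h; [exact: hx | exact: hy].
- by have [_ _ _ h] := hP; apply: h; exact: hx.
Qed.

(** For the torus both claims belong to the definition. For the free group, the elements [g] with
    [u g] in the *-algebra of [S] form a subgroup containing the free generators, hence are all of
    [F]; approximants built from [u] are therefore built from [S]. *)
Lemma torus_or_free_unitary_generated (S : 'I_2 -> A) :
  (exists theta : R, nc_torus theta S) \/ reduced_free_group_cstar S ->
  (forall i, unitary (S i)) /\ cstar_generated_by (range S).
Proof.
case=> [[theta [[US _] genS _]] //|[F [s [u [free_s]]]]].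
move=> [gen_u [H [lambda [delta [rep faithful onb reg]]]]] Su.
have SE i : unitary (S i).
  by rewrite Su; exact: (regular_unitary rep faithful onb reg).
have uM := regular_mul rep faithful onb reg.
have u1 := regular_one rep faithful onb reg.
have uV := regular_star rep faithful onb reg.
split=> // x eps eps0; have [y hy xy] := gen_u x eps eps0.
have [S1 _ SM Sstar] := star_gen_subalg (range S).
exists y => //; apply: hy (star_gen_subalg _) _ => _ [g _ <-].
have /asboolP // : g \in (fun g => `[< star_gen (range S) (u g) >] : bool).
apply: (free_group_generated _ free_s) => [|i].
  split=> [|h k /asboolP uh /asboolP uk]; apply/asboolP; first by rewrite u1.
  by rewrite uM -uV; apply: SM => //; apply: Sstar.
by apply/asboolP => P _; apply; exists i; rewrite ?Su.
Qed.
End SmoothGeneration.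

(** * The grading of the smooth subalgebra *)

Section SmoothAlgebra.
Context {R : realType} {A : cstarType R} {S : 'I_2 -> A}.
Implicit Types (a b : smooth S).

Lemma smooth_star_closed a : star (val a) \in smooth_pred S.
Proof.
have [_ _ _ h] := star_gen_subalg (range S).
by apply/asboolP; apply: h; exact/asboolP/(valP a).
Qed.

Definition smooth_star a : smooth S :=
  exist _ (star (val a)) (smooth_star_closed a).

Lemma smooth_starK a : smooth_star (smooth_star a) = a.
Proof. by apply: val_inj; rewrite /= starK. Qed.

Lemma smooth_starM a b : smooth_star (a * b) = smooth_star b * smooth_star a.
Proof. by apply: val_inj; rewrite /= starM. Qed.

Lemma smooth_star_lin (c : R[i]) a b :
  smooth_star (c *: a + b) = c^* *: smooth_star a + smooth_star b.
Proof. by apply: val_inj; rewrite /= starD starZ. Qed.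

Lemma smooth_star1 : smooth_star 1 = 1.
Proof. by apply: val_inj; rewrite /= star1. Qed.

Lemma smooth_star0 : smooth_star 0 = 0.
Proof. by apply: val_inj; rewrite /= star0. Qed.

Lemma smooth_star_gen i : smooth_star (gen S i) = gen_star S i.
Proof. exact: val_inj. Qed.

Section Derivations.
Context {partial : 'I_2 -> smooth S -> smooth S}.
Hypothesis hpartial : canonical_derivations partial.

Lemma partial_lin i (c : R[i]) a b :
  partial i (c *: a + b) = c *: partial i a + partial i b.
Proof. by have [h _ _ _] := hpartial i. Qed.
Lemma partialM i a b : partial i (a * b) = partial i a * b + a * partial i b.
Proof. by have [_ h _ _] := hpartial i. Qed.
Lemma partialD i a b : partial i (a + b) = partial i a + partial i b.
Proof. by have := partial_lin i 1 a b; rewrite !scale1r. Qed.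
Lemma partial0 i : partial i 0 = 0.
Proof. by apply: (addrI (partial i 0)); rewrite -partialD !addr0. Qed.
Lemma partialZ i (c : R[i]) a : partial i (c *: a) = c *: partial i a.
Proof. by have := partial_lin i c a 0; rewrite partial0 !addr0. Qed.
Lemma partialN i a : partial i (- a) = - partial i a.
Proof. by rewrite -scaleN1r partialZ scaleN1r. Qed.
Lemma partial1 i : partial i 1 = 0.
Proof.
by apply: (addrI (partial i 1)); have := partialM i 1 1;
  rewrite !mulr1 mul1r addr0.
Qed.
Lemma partial_sum i (I : Type) (r : seq I) (f : I -> smooth S) :
  partial i (\sum_(x <- r) f x) = \sum_(x <- r) partial i (f x).
Proof. exact: (big_morph _ (partialD i) (partial0 i)). Qed.

(** * Joint eigenvectors of the derivations and of the torus action *)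

Section Weights.
Context {alpha : ('I_2 -> R[i]) -> A -> A} (halpha : torus_action S alpha).

Definition circle_at (i : 'I_2) (c : R[i]) : 'I_2 -> R[i] :=
  fun j => if i == j then c else 1.

Definition weight (n : 'I_2 -> int) (a : smooth S) : Prop :=
  forall i, partial i a = (n i)%:~R *: a /\
    forall c, `|c| = 1 -> alpha (circle_at i c) (val a) = c ^ n i *: val a.

(** The derivations are prescribed on [gen] and [gen_star] without a rule for the adjoint of a
    general element. Recording the weight of the adjoint as well makes the class stable under
    [smooth_star]. *)
Definition homogeneous (a : smooth S) : Prop :=
  exists n, weight n a /\ weight (fun i => - n i) (smooth_star a).

Lemma circle_at_norm i c : `|c| = 1 -> forall j, `|circle_at i c j| = 1.
Proof.
by move=> hc j; rewrite /circle_at; case: ifP => // _; rewrite normr1.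
Qed.

Lemma circle_star_hom i c : `|c| = 1 -> star_hom (alpha (circle_at i c)).
Proof. by move=> hc; have [h _ _ _] := halpha; apply/h/circle_at_norm. Qed.

Lemma unit_neq0 (c : R[i]) : `|c| = 1 -> c != 0.
Proof. by move=> hc; rewrite -normr_gt0 hc ltr01. Qed.

Lemma weight1 : weight (fun=> 0) 1.
Proof.
move=> i; split=> [|c hc]; first by rewrite partial1 scale0r.
by have [_ _ h _] := circle_star_hom i c hc; rewrite expr0z scale1r.
Qed.

Lemma weightM n m a b :
  weight n a -> weight m b -> weight (fun i => n i + m i) (a * b).
Proof.
move=> ha hb i; have [da aa] := ha i; have [db ab] := hb i; split=> [|c hc].
  by rewrite partialM da db -scalerAl -scalerAr rmorphD scalerDl.
have [_ h _ _] := circle_star_hom i c hc.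
by rewrite /= h aa // ab // -scalerAl -scalerAr scalerA expfzDr // unit_neq0.
Qed.

Lemma alpha_gen i c j : `|c| = 1 ->
  alpha (circle_at i c) (S j) = c ^ (i == j)%:Z *: S j.
Proof.
move=> hc; have [_ _ _ h] := halpha; rewrite h; last exact: circle_at_norm.
by rewrite /circle_at; case: eqP; rewrite ?expr1z ?expr0z.
Qed.

Lemma weight_gen j : weight (fun i => (i == j)%:Z) (gen S j).
Proof.
move=> i; split=> [|c hc]; last exact: alpha_gen.
by have [_ _ h _] := hpartial i; rewrite h; have [->|] := eqVneq i j;
  rewrite ?scale0r.
Qed.

Lemma weight_gen_star j : weight (fun i => - (i == j)%:Z) (gen_star S j).
Proof.
move=> i; split=> [|c hc].
  by have [_ _ _ h] := hpartial i; rewrite h rmorphN scaleNr.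
have [_ _ _ h] := circle_star_hom i c hc; rewrite /= h alpha_gen // starZ.
congr (_ *: _); rewrite rmorphXz /=; last by rewrite unitfE unit_neq0.
by rewrite -exprz_inv invC_norm hc expr1n invr1 mul1r.
Qed.

Lemma homogeneous1 : homogeneous 1.
Proof.
exists (fun=> 0); split; first exact: weight1.
by rewrite smooth_star1 /= oppr0; exact: weight1.
Qed.

Lemma homogeneousM a b : homogeneous a -> homogeneous b -> homogeneous (a * b).
Proof.
move=> [n [na nas]] [m [mb mbs]]; exists (fun i => n i + m i).
split; first exact: weightM.
rewrite smooth_starM; move: (weightM _ _ _ _ mbs nas).
by congr weight; apply/funext => i; rewrite opprD addrC.
Qed.

Lemma homogeneous_gen j : homogeneous (gen S j).
Proof.
exists (fun i => (i == j)%:Z); split; first exact: weight_gen.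
by rewrite smooth_star_gen; exact: weight_gen_star.
Qed.

Lemma homogeneous_star a : homogeneous a -> homogeneous (smooth_star a).
Proof.
move=> [n [na nas]]; exists (fun i => - n i); split=> //; rewrite smooth_starK.
by move: na; congr weight; apply/funext => i; rewrite opprK.
Qed.

(** The linear span of the homogeneous elements, built one term at a time so that linear identities
    on it follow by induction. *)
Inductive homogeneous_sum : smooth S -> Prop :=
| homogeneous_sum0 : homogeneous_sum 0
| homogeneous_sumD c a b : homogeneous a -> homogeneous_sum b ->
    homogeneous_sum (c *: a + b).

Lemma homogeneous_sum_lin c a b :
  homogeneous_sum a -> homogeneous_sum b -> homogeneous_sum (c *: a + b).
Proof.
move=> ha hb; elim: ha => [|c' a' x ha' _ IH]; first by rewrite scaler0 add0r.
by rewrite scalerDr scalerA -addrA; exact: homogeneous_sumD.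
Qed.

Lemma homogeneous_homogeneous_sum a : homogeneous a -> homogeneous_sum a.
Proof.
move=> ha; rewrite -[a]scale1r -[_ *: _]addr0.
by apply: homogeneous_sumD => //; exact: homogeneous_sum0.
Qed.

Lemma homogeneous_sumM a b :
  homogeneous_sum a -> homogeneous_sum b -> homogeneous_sum (a * b).
Proof.
move=> ha hb; elim: ha => [|c a' x ha' _ IH].
  by rewrite mul0r; exact: homogeneous_sum0.
rewrite mulrDl -scalerAl; apply: homogeneous_sum_lin => // {IH}.
elim: hb => [|d b' y hb' _ IH]; first by rewrite mulr0; exact: homogeneous_sum0.
by rewrite mulrDr -scalerAr; apply: homogeneous_sumD => //; exact: homogeneousM.
Qed.

Lemma homogeneous_sum_star a :
  homogeneous_sum a -> homogeneous_sum (smooth_star a).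
Proof.
elim=> [|c b x hb _ IH]; first by rewrite smooth_star0; exact: homogeneous_sum0.
rewrite smooth_star_lin.
by apply: homogeneous_sumD => //; exact: homogeneous_star.
Qed.

(** Sums of homogeneous elements form a *-subalgebra containing the generators, hence contain the
    *-algebra that these generate. *)
Lemma smooth_homogeneous_sum a : homogeneous_sum a.
Proof.
have /asboolP := valP a.
move=> /(_ [set x : A | exists2 b, homogeneous_sum b & val b = x]) [].
- split=> [|c _ _ [x hx <-] [y hy <-]|_ _ [x hx <-] [y hy <-]|_ [x hx <-]].
  + by exists 1 => //; exact/homogeneous_homogeneous_sum/homogeneous1.
  + by exists (c *: x + y) => //; exact: homogeneous_sum_lin.
  + by exists (x * y) => //; exact: homogeneous_sumM.
  + by exists (smooth_star x) => //; exact: homogeneous_sum_star.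
- move=> _ [j _ <-]; exists (gen S j) => //.
  exact/homogeneous_homogeneous_sum/homogeneous_gen.
by move=> b hb /val_inj <-.
Qed.

Lemma partialC i j a : partial i (partial j a) = partial j (partial i a).
Proof.
elim: (smooth_homogeneous_sum a) => [|c b x [n [nb _]] _ IH];
  first by rewrite !partial0.
rewrite !partial_lin IH (nb i).1 (nb j).1 !partialZ (nb i).1 (nb j).1 !scalerA.
by congr (_ *: _ + _); rewrite mulrAC.
Qed.

(** On an element of weight [n] the derivative carries the factor [n i]. Either this is [0], or a
    rotation of the coordinate [i] forces the state to vanish on the element. *)
Lemma invariant_state_partial (tau : A -> R[i]) i a :
  state tau -> invariant_state alpha tau -> tau (val (partial i a)) = 0.
Proof.
move=> tau_state inv.
have tau0 : tau 0 = 0 by rewrite -(scale0r 0) stateZ // mul0r.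
elim: (smooth_homogeneous_sum a) => [|c b x [n [nb _]] _ IH];
  first by rewrite partial0.
rewrite partial_lin (nb i).1 [val _]/= stateD // IH addr0 !stateZ //.
have [->|n0] := eqVneq (n i) 0; first by rewrite mul0r mulr0.
(* A root of $-1$ of order $|n_i|$; its powers of exponent $n_i$ and $-n_i$ both equal $-1$, which
   settles the sign of [n i]. Invariance under [z] then reads $\tau(b) = -\tau(b)$. *)
have [z z1 zn] : exists2 z : R[i], `|z| = 1 & z ^ n i = -1.
  pose m := `|n i|%N; have m0 : (0 < m)%N by rewrite absz_gt0.
  pose z := m.-root (-1 : R[i]).
  have zm : z ^+ m = -1 by rewrite rootCK.
  have z1 : `|z| = 1.
    by apply/eqP; rewrite -(@pexpr_eq1 _ _ m) // -normrX zm normrN1.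
  exists z => //; rewrite [n i]intEsign -/m.
  case: (n i < 0); rewrite ?expr0 ?expr1 ?mul1r ?mulN1r -?exprz_inv -?exprnP //.
  by rewrite exprVn zm invrN1.
have := inv (circle_at i z) (val b) (circle_at_norm i z z1).
rewrite (nb i).2 // stateZ // zn mulN1r => /eqP.
by rewrite eq_sym -addr_eq0 -mulr2n mulrn_eq0 /= => /eqP ->; rewrite !mulr0.
Qed.
End Weights.
End Derivations.
End SmoothAlgebra.

(** * Connes' calculus *)

Lemma sum_ord2 (V : nmodType) (f : 'I_2 -> V) : \sum_i f i = f ord0 + f ord_max.
Proof.
by rewrite big_ord_recl big_ord1; congr (_ + f _); exact: val_inj.
Qed.

Lemma ord2P (P : 'I_2 -> Prop) : P ord0 -> P ord_max -> forall i, P i.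
Proof.
move=> P0 P1 [[|[|//]] hi].
- by rewrite (_ : Ordinal hi = ord0) //; exact: val_inj.
- by rewrite (_ : Ordinal hi = ord_max) //; exact: val_inj.
Qed.

Lemma pair_continuous (T U V : topologicalType) (f : T -> U) (g : T -> V) :
  continuous f -> continuous g -> continuous (fun x => (f x, g x)).
Proof. by move=> fc gc x; apply: cvg_pair; [exact: fc | exact: gc]. Qed.

Lemma addrr_eq0 (F : numFieldType) (V : lmodType F) (x : V) : x + x = 0 ->
  x = 0.
Proof.
rewrite -mulr2n -scaler_nat => x0.
by rewrite -[x]scale1r -(@mulVf _ 2%:R) ?pnatr_eq0 // -scalerA x0 scaler0.
Qed.

(** * Complex matrices acting on spinors *)

Section SpinorMatrices.
Context {R : realType} {H : hilbertType R}.
Implicit Types (c d : 'M[R[i]]_2) (v w : (H * H)%type).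

Lemma spinor_mx_lin c (x : R[i]) v w :
  spinor_mx c (x *: v + w) = x *: spinor_mx c v + spinor_mx c w.
Proof.
by rewrite /spinor_mx; congr (_, _); rewrite /= !scalerDr !scalerA addrACA;
  congr (_ + _); congr (_ *: _ + _ *: _); rewrite mulrC.
Qed.

Lemma spinor_mxDr c v w : spinor_mx c (v + w) = spinor_mx c v + spinor_mx c w.
Proof. by have := spinor_mx_lin c 1 v w; rewrite !scale1r. Qed.

Lemma spinor_mx0r c : spinor_mx c (0 : (H * H)%type) = 0.
Proof. by apply: (addrI (spinor_mx c 0)); rewrite -spinor_mxDr !addr0. Qed.

Lemma spinor_mx_sumr c (I : Type) (r : seq I) (f : I -> (H * H)%type) :
  spinor_mx c (\sum_(j <- r) f j) = \sum_(j <- r) spinor_mx c (f j).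
Proof. exact: (big_morph _ (spinor_mxDr c) (spinor_mx0r c)). Qed.

Lemma spinor_mxNl c v : spinor_mx (- c) v = - spinor_mx c v.
Proof.
by rewrite /spinor_mx !mxE; congr (_, _); rewrite /= !scaleNr opprD.
Qed.

Lemma spinor_mxNr c v : spinor_mx c (- v) = - spinor_mx c v.
Proof.
by rewrite /spinor_mx; congr (_, _); rewrite /= !scalerN opprD.
Qed.

Lemma spinor_mxM c d v : spinor_mx (c *m d) v = spinor_mx c (spinor_mx d v).
Proof.
rewrite /spinor_mx !mxE !sum_ord2.
by congr (_, _); rewrite /= !scalerDl !scalerDr !scalerA addrACA.
Qed.

Lemma spinor_mx1 v : spinor_mx 1%:M v = v.
Proof.
by case: v => v w; rewrite /spinor_mx !mxE /= !scale1r !scale0r addr0 add0r.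
Qed.

Lemma spinor_mx_cont c : continuous (spinor_mx c : H * H -> H * H).
Proof.
apply: pair_continuous => v.
  by apply: cvgD; apply: cvgZl_tmp; [exact: cvg_fst | exact: cvg_snd].
by apply: cvgD; apply: cvgZl_tmp; [exact: cvg_fst | exact: cvg_snd].
Qed.

End SpinorMatrices.

(** * Commutators with the Dirac operator *)

Section Connes.
Context {R : realType} {A : cstarType R} {S : 'I_2 -> A}.
Context {partial : 'I_2 -> smooth S -> smooth S}.
Context {tau0 : A -> R[i]} {H : hilbertType R} {rho : A -> H -> H} {xi : H}.
Context {gamma : 'I_2 -> 'M[R[i]]_2}.
Hypotheses (genS : cstar_generated_by (range S))
  (unitS : forall i, unitary (S i)).
Hypotheses (hpartial : canonical_derivations partial).
Hypotheses (hpartialC :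
  forall i j a, partial i (partial j a) = partial j (partial i a)).
Hypotheses (htau0 : faithful_state tau0) (hGNS : GNS tau0 rho xi).
Hypotheses (hgamma : clifford gamma).

Local Notation pD := (partialD hpartial).
Local Notation pM := (partialM hpartial).
Implicit Types (a b x y : smooth S) (v w : (H * H)%type) (c : 'M[R[i]]_2).
Local Notation g1 := (gamma ord0).
Local Notation g2 := (gamma ord_max).

Let rep : star_rep rho. Proof. by have [] := hGNS. Qed.

Lemma GNS_norm (a : A) : `|rho a xi| ^+ 2 = tau0 (star a * a).
Proof.
have [_ h _] := hGNS.
by rewrite h (repM rep) -dot_norm (rep_adj rep).
Qed.

Lemma GNS_separating (a : A) : rho a xi = 0 -> a = 0.
Proof.
by move=> a0; apply: (htau0.2); rewrite -GNS_norm a0 normr0 expr0n.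
Qed.

(** The vector [xi] is cyclic for [A], the smooth algebra is norm dense in [A], and [state_bounded]
    turns closeness in the C*-norm into closeness in the GNS space. *)
Lemma smooth_dense : closure [set rho (val a) xi | a in [set: smooth S]] = setT.
Proof.
have [_ _ cyclic] := hGNS.
set E := [set rho (val a) xi | a in _]; apply/seteqP; split=> // w _.
rewrite (iffLR (closure_id (closure E)) (@closed_closure _ E)).
have : closure [set rho a xi | a in setT] w by rewrite cyclic.
apply: closureS => _ [a _ <-] B /nbhs_ballP[eps /= eps0 epsB].
(* Radii of balls in [H] live in [R[i]]; positivity makes the radius a real number [r]. *)
case: eps eps0 epsB => r i; rewrite ltcE /= => /andP[/eqP -> r0].
rewrite -[Complex r 0]/(r%:C%C) => epsB.
(* Distance $r/2$ suffices because $2 (r/2)^2 < r^2$ in the bound of [state_bounded]. *)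
have [b hb ab] := genS a (r / 2) (divr_gt0 r0 (ltr0Sn _ _)).
have bS : b \in smooth_pred S by apply/asboolP.
exists (rho b xi); split; first by exists (exist _ b bS).
apply: epsB; rewrite -ball_normE /=.
have -> : rho a xi - rho b xi = rho (a - b) xi.
  by rewrite (repDl rep) (repNl rep).
rewrite -(@ltr_pXn2r _ 2) // ?nnegrE //; last by rewrite lecR ltW.
rewrite GNS_norm; apply: le_lt_trans (state_bounded _ _ htau0.1) _.
rewrite -rmorphXn ltcR; have := cnorm_ge0 (a - b); move: ab; nra.
Qed.

Lemma spinor_mulDl a b v :
  spinor_mul rho (a + b) v = spinor_mul rho a v + spinor_mul rho b v.
Proof. by rewrite /spinor_mul !(repDl rep). Qed.
Lemma spinor_mulDr a v w :
  spinor_mul rho a (v + w) = spinor_mul rho a v + spinor_mul rho a w.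
Proof. by rewrite /spinor_mul !(repDr rep). Qed.
Lemma spinor_mul0l v : spinor_mul rho (0 : smooth S) v = 0.
Proof. by rewrite /spinor_mul !(rep0l rep). Qed.
Lemma spinor_mul0r a : spinor_mul rho a 0 = 0.
Proof. by rewrite /spinor_mul !(rep0r rep). Qed.
Lemma spinor_mulNl a v : spinor_mul rho (- a) v = - spinor_mul rho a v.
Proof. by rewrite /spinor_mul !(repNl rep). Qed.
Lemma spinor_mulM a b v :
  spinor_mul rho (a * b) v = spinor_mul rho a (spinor_mul rho b v).
Proof. by rewrite /spinor_mul !(repM rep). Qed.
Lemma spinor_mulNr a v : spinor_mul rho a (- v) = - spinor_mul rho a v.
Proof. by rewrite /spinor_mul !(repNr rep). Qed.
Lemma spinor_mul1 v : spinor_mul rho (1 : smooth S) v = v.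
Proof. by case: v => v w; rewrite /spinor_mul !(rep1 rep). Qed.
Lemma spinor_mul_lin a (z : R[i]) v w :
  spinor_mul rho a (z *: v + w) = z *: spinor_mul rho a v + spinor_mul rho a w.
Proof. by rewrite /spinor_mul !(rep_lin rep). Qed.
Lemma spinor_mul_sumr a (I : Type) (r : seq I) (f : I -> (H * H)%type) :
  spinor_mul rho a (\sum_(j <- r) f j) = \sum_(j <- r) spinor_mul rho a (f j).
Proof. exact: (big_morph _ (spinor_mulDr a) (spinor_mul0r a)). Qed.

Lemma spinor_mul_mx a c v :
  spinor_mul rho a (spinor_mx c v) = spinor_mx c (spinor_mul rho a v).
Proof. by rewrite /spinor_mul /spinor_mx /= !(repDr rep) !(repZr rep). Qed.

Lemma spinor_mul_cont a : continuous (spinor_mul rho a : H * H -> H * H).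
Proof.
apply: pair_continuous => v.
  by apply: continuous_comp; [exact: cvg_fst | exact: (rep_cont rep)].
by apply: continuous_comp; [exact: cvg_snd | exact: (rep_cont rep)].
Qed.

Lemma spinor_mul_spinor a (b : smooth S * smooth S) :
  spinor_mul rho a (spinor rho xi b) = spinor rho xi (a * b.1, a * b.2).
Proof. by rewrite /spinor_mul /spinor /= !(repM rep). Qed.

Lemma spinorD (b b' : smooth S * smooth S) :
  spinor rho xi (b + b') = spinor rho xi b + spinor rho xi b'.
Proof. by rewrite /spinor /= !(repDl rep). Qed.

Definition dirac_form a v :=
  \sum_i spinor_mx (gamma i) (spinor_mul rho (partial i a) v).

(** By the Leibniz rule the terms $a \partial_i b$ cancel in the commutator, and what remains acts
    through $\partial_i a$, a bounded operator. *)
Lemma dirac_form_comm a : is_dirac_comm rho xi gamma partial a (dirac_form a).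
Proof.
split=> [z v w|v|b].
- rewrite /dirac_form scaler_sumr -big_split; apply: eq_bigr => i _ /=.
  by rewrite spinor_mul_lin spinor_mx_lin.
- rewrite (_ : dirac_form a = fun v =>
      spinor_mx g1 (spinor_mul rho (partial ord0 a) v) +
      spinor_mx g2 (spinor_mul rho (partial ord_max a) v)); last first.
    by apply/funext => ?; rewrite /dirac_form sum_ord2.
  by apply: cvgD; apply: continuous_comp;
    [exact: spinor_mul_cont | exact: spinor_mx_cont
    |exact: spinor_mul_cont | exact: spinor_mx_cont].
- rewrite /dirac_op spinor_mul_sumr -sumrB; apply: eq_bigr => i _.
  rewrite spinor_mul_mx -[- _]/(- _) -spinor_mxNr -spinor_mxDr; congr spinor_mx.
  rewrite !spinor_mul_spinor -[X in X - _]/(spinor rho xi (_, _)) !pM /=.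
  by apply/eqP; rewrite eq_sym subr_eq -spinorD eq_sym; apply/eqP.
Qed.

(** The operator [dirac_comm a] is obtained by choice, so uniqueness is what counts: two continuous
    linear maps that agree on the smooth spinors are equal by density. *)
Lemma dirac_commE a : dirac_comm rho xi gamma partial a = dirac_form a.
Proof.
apply: xget_unique; first exact: dirac_form_comm.
move=> T [Tlin Tcont Tval]; have [Flin Fcont Fval] := dirac_form_comm a.
apply/funext => v.
pose D w := T w - dirac_form a w.
have DD v' w' : D (v' + w') = D v' + D w'.
  by rewrite /D -[v']scale1r Tlin Flin !scale1r opprD addrACA.
have Dcont : continuous D.
  by move=> w; apply: cvgB; [exact: Tcont | exact: Fcont].
have Dclosed : closed (D @^-1` [set 0]).
  apply: closed_comp; first by move=> w _; exact: Dcont.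
  exact/accessible_closed_set1/hausdorff_accessible/norm_hausdorff.
have Dspinor (b : smooth S * smooth S) : D (spinor rho xi b) = 0.
  by rewrite /D Tval Fval subrr.
(* Density is known in [H] only, so it is applied to each summand separately, [j] being the
   inclusion of a summand. *)
have Ddense (j : H -> (H * H)%type) : continuous j ->
    (forall b, D (j (rho (val b) xi)) = 0) -> forall w : H, D (j w) = 0.
  move=> jc j0 w; have : closure [set rho (val b) xi | b in [set: smooth S]] w.
    by rewrite smooth_dense.
  rewrite closureE => /(_ (j @^-1` (D @^-1` [set 0]))); apply; split.
    by apply: closed_comp => // u _; exact: jc.
  by move=> _ [b _ <-]; exact: j0.
have Dfst (w : H) : D (w, 0) = 0.
  apply: (Ddense (fun w : H => (w, 0))) => [|b].
    by apply: pair_continuous => u; [exact: cvg_id | exact: cvg_cst].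
  by have := Dspinor (b, 0); rewrite /spinor /= (rep0l rep).
have Dsnd (w : H) : D (0, w) = 0.
  apply: (Ddense (fun w : H => (0, w))) => [|b].
    by apply: pair_continuous => u; [exact: cvg_cst | exact: cvg_id].
  by have := Dspinor (0, b); rewrite /spinor /= (rep0l rep).
apply/eqP; rewrite -subr_eq0; apply/eqP; rewrite -/(D v).
have -> : v = (v.1, 0) + (0, v.2) by case: v => ? ?; congr (_, _);
  rewrite /= ?addr0 ?add0r.
by rewrite DD Dfst Dsnd addr0.
Qed.

Lemma spinor_mul_eq0 a : (forall v, spinor_mul rho a v = 0) -> a = 0.
Proof.
move=> a0; apply: val_inj; apply: GNS_separating.
by have := congr1 fst (a0 (xi, 0)).
Qed.

Lemma gammaK i v : spinor_mx (gamma i) (spinor_mx (gamma i) v) = v.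
Proof. by rewrite -spinor_mxM hgamma.1 spinor_mx1. Qed.

Lemma gamma_anticomm v :
  spinor_mx g2 (spinor_mx g1 v) = - spinor_mx g1 (spinor_mx g2 v).
Proof. by rewrite -!spinor_mxM hgamma.2 spinor_mxNl opprK. Qed.

(** Conjugation by $\gamma_1$ fixes [a] and changes the sign of $\gamma_1 \gamma_2$. Adding the
    relation to its conjugate leaves $2a = 0$, after which $\gamma_1$ and $\gamma_2$ are cancelled
    in front of [b]. *)
Lemma clifford_even_free a b :
  (forall v, spinor_mul rho a v
     + spinor_mx g1 (spinor_mx g2 (spinor_mul rho b v)) = 0) ->
  a = 0 /\ b = 0.
Proof.
move=> ab; have a0 : a = 0.
  apply/addrr_eq0/spinor_mul_eq0 => v;
  rewrite spinor_mulDl -[RHS]addr0 -[X in _ = X + _](ab v).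
  rewrite -(spinor_mx0r g1) -(ab (spinor_mx g1 v)) spinor_mxDr -!spinor_mul_mx.
  by rewrite !gammaK gamma_anticomm spinor_mulNr addrACA subrr addr0.
split=> //; apply: spinor_mul_eq0 => v.
have := ab v; rewrite a0 spinor_mul0l add0r => b0.
move: b0 => /(congr1 (spinor_mx g1)); rewrite gammaK spinor_mx0r.
by move=> /(congr1 (spinor_mx g2)); rewrite gammaK spinor_mx0r.
Qed.

(** Multiplication by $\gamma_1$ on the left reduces this to [clifford_even_free]. *)
Lemma clifford_odd_free (a : 'I_2 -> smooth S) :
  (forall v, \sum_i spinor_mx (gamma i) (spinor_mul rho (a i) v) = 0) ->
  forall i, a i = 0.
Proof.
move=> ha; have [] := @clifford_even_free (a ord0) (a ord_max).
  by move=> v; rewrite -[RHS](spinor_mx0r g1) -(ha v) sum_ord2 spinor_mxDr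
    gammaK.
exact: ord2P.
Qed.

(** * Junk in degrees one and two *)

Local Notation upi := (upi rho xi gamma partial).
Local Notation junk := (junk rho xi gamma partial).

Lemma dirac_form0 v : dirac_form 0 v = 0.
Proof.
by rewrite /dirac_form big1 // => i _; rewrite (partial0 hpartial) spinor_mul0l
  spinor_mx0r.
Qed.

Lemma dirac_formD a b v :
  dirac_form (a + b) v = dirac_form a v + dirac_form b v.
Proof.
rewrite /dirac_form -big_split; apply: eq_bigr => i _ /=.
by rewrite pD spinor_mulDl spinor_mxDr.
Qed.

Lemma dirac_form_add a v w :
  dirac_form a (v + w) = dirac_form a v + dirac_form a w.
Proof.
rewrite /dirac_form -big_split; apply: eq_bigr => i _ /=.
by rewrite spinor_mulDr spinor_mxDr.
Qed.

Lemma dirac_form_zero a : dirac_form a 0 = 0.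
Proof. by apply: (addrI (dirac_form a 0)); rewrite -dirac_form_add !addr0. Qed.

Lemma dirac_formM a b v :
  dirac_form (a * b) v =
    dirac_form a (spinor_mul rho b v) + spinor_mul rho a (dirac_form b v).
Proof.
rewrite /dirac_form spinor_mul_sumr -big_split; apply: eq_bigr => i _ /=.
by rewrite pM spinor_mulDl spinor_mxDr !spinor_mulM spinor_mul_mx.
Qed.

Lemma dirac_form_sum (I : Type) (r : seq I) (f : I -> smooth S) v :
  dirac_form (\sum_(i <- r) f i) v = \sum_(i <- r) dirac_form (f i) v.
Proof.
exact: (big_morph (dirac_form^~ v)
  (fun a b => dirac_formD a b v) (dirac_form0 v)).
Qed.

Definition coef i (s : uform S 1) : smooth S :=
  \sum_(p <- s) p.1 * partial i (thead p.2).

Lemma upi1E s v :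
  upi s v = \sum_i spinor_mx (gamma i) (spinor_mul rho (coef i s) v).
Proof.
rewrite /coef; elim: s => [|[a [[|b [|//]] // hb]] s IH].
  rewrite /upi big_nil big1 // => i _.
  by rewrite big_nil spinor_mul0l spinor_mx0r.
rewrite /upi big_cons -/(upi s v) IH /= dirac_commE spinor_mul_sumr -big_split.
apply: eq_bigr => i _ /=; rewrite big_cons spinor_mulDl spinor_mxDr;
  congr (_ + _).
by rewrite spinor_mulM spinor_mul_mx.
Qed.

(** The differential of $\sum a\, \delta b$ is represented by $\sum_{i,j} \gamma_i \gamma_j \sum
    \partial_i a\, \partial_j b$. As the coefficients of [s] are constant, the inner sum is $-\sum
    a\, \partial_i \partial_j b$, which is symmetric in $i, j$. The anticommuting products cancel
    and the squares $\gamma_i^2 = 1$ leave a scalar. Zero coefficients give the junk, constant ones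
    the differentials of the frame. *)
Lemma udelta_scalar (s : uform S 1) :
  (forall i j, partial i (coef j s) = 0) ->
  forall v, upi (udelta s) v = spinor_mul rho
    (- \sum_i \sum_(p <- s) p.1 * partial i (partial i (thead p.2))) v.
Proof.
move=> s0 v.
pose q i j := \sum_(p <- s) p.1 * partial i (partial j (thead p.2)).
have dq i j : \sum_(p <- s) partial i p.1 * partial j (thead p.2) = - q i j.
  apply/eqP; rewrite -addr_eq0 -big_split /=; apply/eqP; rewrite -[RHS](s0 i j).
  by rewrite /coef (partial_sum hpartial); apply: eq_bigr => p _; rewrite pM.
have -> : upi (udelta s) v = \sum_i \sum_j spinor_mx (gamma i)
    (spinor_mx (gamma j) (spinor_mul rho (- q i j) v)).
  under eq_bigr do under eq_bigr do rewrite -dq.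
  elim: (s) => [|[a [[|b [|//]] // hb]] r IH].
    rewrite /upi big_nil big1 // => i _; rewrite big1 // => j _.
    by rewrite big_nil spinor_mul0l !spinor_mx0r.
  rewrite /upi big_cons -/(upi (udelta r) v) IH /= spinor_mul1 !dirac_commE.
  rewrite -big_split; apply: eq_bigr => i _ /=.
  rewrite spinor_mul_sumr spinor_mx_sumr -big_split; apply: eq_bigr => j _ /=.
  by rewrite big_cons spinor_mulDl !spinor_mxDr spinor_mulM spinor_mul_mx.
have qC : q ord_max ord0 = q ord0 ord_max.
  by apply: eq_bigr => p _; rewrite hpartialC.
rewrite !sum_ord2 !gammaK gamma_anticomm qC addrA addrK.
by rewrite -spinor_mulDl -opprD.
Qed.

(** In degree zero [upi] is injective: a formal sum represented by [0] has total [0], and its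
    differential is represented by the commutator with that total. *)
Lemma junk1_eq0 T : junk 1 T -> forall v, T v = 0.
Proof.
move=> [s /= s0 <-] v.
have {}s0 : \sum_(p <- s) p.1 = 0.
  apply: spinor_mul_eq0 => w; rewrite -[RHS]/((fun=> 0) w) -s0 /upi.
  elim: (s) => [|[a [[|//] ha]] r IH]; first by rewrite !big_nil spinor_mul0l.
  by rewrite !big_cons spinor_mulDl IH.
transitivity (dirac_form (\sum_(p <- s) p.1) v); last by rewrite s0 dirac_form0.
rewrite /upi /udelta big_map dirac_form_sum;
apply: eq_bigr => -[a [[|//] ha]] _ /=.
by rewrite spinor_mul1 dirac_commE.
Qed.

Lemma junk2_scalar T : junk 2 T -> exists x, forall v, T v = spinor_mul rho x v.
Proof.
move=> [s /= s0 <-]; eexists; apply: udelta_scalar => i j.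
suff -> : coef j s = 0 by rewrite (partial0 hpartial).
by apply: (@clifford_odd_free (coef^~ s)) => v; rewrite -upi1E s0.
Qed.

(* With [u] a generator, [u^* d u + u d u^*] is represented by [0] while its
   differential is represented by [-2]. *)
Lemma scalar_junk2 x : junk 2 (spinor_mul rho x).
Proof.
have [u1 u2] := unitS ord0.
pose u := gen S ord0; pose u' := gen_star S ord0.
have uu : u' * u = 1 by exact: val_inj.
have uu' : u * u' = 1 by exact: val_inj.
have du i : partial i u = (i == ord0)%:R *: u.
  by have [_ _ h _] := hpartial i; rewrite h; have [->|] := eqVneq i ord0;
    rewrite ?scale0r.
have du' i : partial i u' = - ((i == ord0)%:R *: u')
  by have [_ _ _ ->] := hpartial i.
(* The factor $-1/2$ compensates the $-2$, so that the differential of [s] is represented by exactly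
   [x]. *)
pose y : smooth S := - ((2^-1 : R[i]) *: x).
pose s : uform S 1 := [:: (y * u', [tuple u]); (y * u, [tuple u'])].
have cs i : coef i s = 0.
  rewrite /coef big_cons big_seq1 /= !theadE du du' mulrN -!scalerAr -!mulrA.
  by rewrite uu uu' subrr.
have ddu i : partial i (partial i u) = (i == ord0)%:R *: u.
  by rewrite du (partialZ hpartial) du scalerA -natrM mulnb andbb.
have ddu' i : partial i (partial i u') = (i == ord0)%:R *: u'.
  by rewrite du' (partialN hpartial) (partialZ hpartial) du' scalerN opprK
    scalerA -natrM mulnb andbb.
exists s.
  by apply/funext => v; rewrite /= upi1E big1 // => i _;
    rewrite cs spinor_mul0l spinor_mx0r.
apply/funext => v; rewrite udelta_scalar => [|i j];
  last by rewrite cs (partial0 hpartial).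
congr spinor_mul; rewrite sum_ord2 !big_cons !big_nil /= !theadE !ddu !ddu' /=.
rewrite !scale0r !scale1r !mulr0 !addr0 -!mulrA uu uu' mulr1 -opprD opprK
  -scalerDl.
have -> : 2^-1 + 2^-1 = 1 :> R[i] by field.
by rewrite scale1r.
Qed.

(** * Differential forms and the operators representing them *)

Local Set Implicit Arguments.
Local Unset Strict Implicit.
Context {Om : calculus (smooth S)}.
Hypothesis hOm : connes_calculus rho xi gamma partial Om.
Local Notation iota := (alg_incl Om).
Local Notation d := (dga_d Om).
Implicit Types (omega eta : carrier Om) (T : (H * H)%type -> (H * H)%type).

(* [omega] is the class in [Om^n] of the operator [T]. *)
Definition represents n omega T :=
  exists s : uform S n, omega = ueval Om s /\ forall v, upi s v = T v.

(** Equations between forms become membership of operators in the junk, whichever universal form is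
    used as representative. *)
Lemma represents_eq0 n omega T : represents n omega T ->
  (omega = 0 <-> junk n T).
Proof.
move=> [s [-> sT]]; have -> : T = upi s by apply/funext => v; rewrite sT.
exact: hOm.
Qed.

Lemma represents_ext n omega T T' :
  (forall v, T v = T' v) -> represents n omega T -> represents n omega T'.
Proof. by move=> TT' [s [-> sT]]; exists s; split=> // v; rewrite sT. Qed.

Lemma represents0 n : represents n 0 (fun=> 0).
Proof.
by exists [::]; split=> [|v]; [rewrite /ueval | rewrite /upi]; rewrite big_nil.
Qed.

Lemma represents_zero n omega T : represents n omega T -> (forall v, T v = 0) ->
  omega = 0.
Proof.
move=> h T0; apply/(represents_eq0 (represents_ext T0 h)).
by case: n h => [|n] _ //=; exists [::]; apply/funext => v;
  rewrite /upi /udelta /= big_nil.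
Qed.

Lemma representsD n omega eta T T' : represents n omega T ->
  represents n eta T' ->
  represents n (omega + eta) (fun v => T v + T' v).
Proof.
move=> [s [-> sT]] [t [-> tT]]; exists (s ++ t).
by split=> [|v]; rewrite -?sT -?tT ?/ueval ?/upi big_cat.
Qed.

Lemma represents_sum n (I : Type) (r : seq I) (f : I -> carrier Om) F :
  (forall i, represents n (f i) (F i)) ->
  represents n (\sum_(i <- r) f i) (fun v => \sum_(i <- r) F i v).
Proof.
move=> fF; elim: r => [|i r IH].
  by rewrite big_nil; apply: represents_ext (represents0 n) => v;
    rewrite big_nil.
by rewrite big_cons; apply: represents_ext (representsD (fF i) IH) => v;
  rewrite big_cons.
Qed.

Lemma represents_lact n a omega T : represents n omega T ->
  represents n (iota a * omega) (fun v => spinor_mul rho a (T v)).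
Proof.
move=> [s [-> sT]]; exists [seq (a * p.1, p.2) | p <- s]; split=> [|v].
  rewrite /ueval big_map mulr_sumr; apply: eq_bigr => p _ /=.
  by rewrite rmorphM mulrA.
rewrite -sT /upi big_map spinor_mul_sumr; apply: eq_bigr => p _ /=.
by rewrite spinor_mulM.
Qed.

Lemma representsN n omega T : represents n omega T ->
  represents n (- omega) (fun v => - T v).
Proof.
move=> /(represents_lact (-1)); rewrite rmorphN1 mulN1r;
  apply: represents_ext => v.
by rewrite spinor_mulNl spinor_mul1.
Qed.

Lemma representsB n omega eta T T' : represents n omega T ->
  represents n eta T' ->
  represents n (omega - eta) (fun v => T v - T' v).
Proof. by move=> h h'; apply: representsD h (representsN h'). Qed.

Lemma represents_d a : represents 1 (d (iota a)) (dirac_form a).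
Proof.
exists [:: (1, [tuple a])]; split=> [|v].
  by rewrite /ueval big_seq1 /= rmorph1 mul1r big_seq1.
by rewrite /upi big_seq1 /= spinor_mul1 dirac_commE.
Qed.

Lemma represents_dd a b :
  represents 2 (d (iota a) * d (iota b))
    (fun v => dirac_form a (dirac_form b v)).
Proof.
exists [:: (1, [tuple a; b])]; split=> [|v].
  by rewrite /ueval big_seq1 /= rmorph1 mul1r big_cons big_seq1.
by rewrite /upi big_seq1 /= spinor_mul1 !dirac_commE.
Qed.

Lemma iota_deg0 a : iota a \in deg Om 0.
Proof. by apply/alg_incl_deg; exists a. Qed.

Lemma d_iotaM a b :
  d (iota (a * b)) = d (iota a) * iota b + iota a * d (iota b).
Proof. by rewrite rmorphM (dga_dM _ (iota_deg0 a)) expr0 mul1r. Qed.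

Lemma ueval1E (s : uform S 1) :
  ueval Om s = \sum_(p <- s) iota p.1 * d (iota (thead p.2)).
Proof.
rewrite /ueval; apply: eq_bigr => -[a [[|b [|//]] // hb]] _ /=.
by rewrite big_seq1.
Qed.

Lemma upi1_sum (s : uform S 1) v :
  upi s v = \sum_(p <- s) spinor_mul rho p.1 (dirac_form (thead p.2) v).
Proof.
rewrite /upi; apply: eq_bigr => -[a [[|b [|//]] // hb]] _ /=.
by rewrite dirac_commE.
Qed.

(** A product $a_0\, da_1\, b$ is not in the normal form of [uform]; the rewriting $(da_1) b = d(a_1
    b) - a_1\, db$ restores it, and [dirac_form] obeys the same rule. *)
Lemma represents_ract omega T b : represents 1 omega T ->
  represents 1 (omega * iota b) (fun v => T (spinor_mul rho b v)).
Proof.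
move=> [s [-> sT]]; rewrite ueval1E mulr_suml.
apply: represents_ext (represents_sum s (F := fun p v =>
  spinor_mul rho p.1 (dirac_form (thead p.2) (spinor_mul rho b v))) _).
  by move=> v; rewrite -sT upi1_sum.
move=> p; rewrite -mulrA; apply: represents_lact.
have -> : d (iota (thead p.2)) * iota b =
    d (iota (thead p.2 * b)) - iota (thead p.2) * d (iota b)
      by rewrite d_iotaM addrK.
apply: represents_ext (representsB (represents_d _) (represents_lact _
  (represents_d _))) => v.
by rewrite dirac_formM addrK.
Qed.

(** The function standing between the two differentials is moved to the left by the Leibniz rule, as
    for [represents_ract]. *)
Lemma represents_wedge omega eta T T' :
  represents 1 omega T -> represents 1 eta T' ->
  represents 2 (omega * eta) (fun v => T (T' v)).
Proof.
move=> [s [-> sT]] [t [-> tT]]; rewrite !ueval1E mulr_suml.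
apply: represents_ext (represents_sum s (F := fun p v =>
  spinor_mul rho p.1 (dirac_form (thead p.2) (T' v))) _).
  by move=> v; rewrite -sT upi1_sum.
move=> p; rewrite -mulrA; apply: represents_lact; rewrite mulr_sumr.
apply: represents_ext (represents_sum t (F := fun q v =>
  dirac_form (thead p.2) (spinor_mul rho q.1 (dirac_form (thead q.2) v))) _).
  move=> v; rewrite -tT upi1_sum.
  by apply/esym/(big_morph _ (dirac_form_add _) (dirac_form_zero _)).
move=> q; rewrite mulrA.
have -> : d (iota (thead p.2)) * iota q.1 =
    d (iota (thead p.2 * q.1)) - iota (thead p.2) * d (iota q.1)
      by rewrite d_iotaM addrK.
rewrite mulrBl -mulrA.
apply: represents_ext (representsB (represents_dd _ _) (represents_lact _
  (represents_dd _ _))) => v.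
by rewrite dirac_formM addrK.
Qed.

Lemma d_ueval1 (s : uform S 1) : d (ueval Om s) = ueval Om (udelta s).
Proof.
rewrite ueval1E /ueval /udelta big_map linear_sum.
apply: eq_bigr => -[a [[|b [|//]] // hb]] _ /=.
rewrite (dga_dM _ (iota_deg0 a)) dga_dd !mulr0 addr0 rmorph1 mul1r.
by rewrite big_cons big_seq1.
Qed.

(** * Algebraic relations of the canonical frame *)

Context {e : 'I_2 -> Omega Om 1}.
Hypothesis he : canonical_frame rho xi gamma partial e.

Lemma frame_represents i : represents 1 (val (e i)) (spinor_mx (gamma i)).
Proof. by have [s [es sT]] := he i; exists s; split=> // v; rewrite sT. Qed.

Lemma frame_coef_represents (b : 'I_2 -> smooth S) :
  represents 1 (\sum_i val (e i) * iota (b i))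
    (fun v => \sum_i spinor_mx (gamma i) (spinor_mul rho (b i) v)).
Proof.
by apply: represents_sum => i; exact/represents_ract/frame_represents.
Qed.

Lemma frame_central i a : iota a * val (e i) = val (e i) * iota a.
Proof.
apply/eqP; rewrite -subr_eq0; apply/eqP.
apply: represents_zero (representsB (represents_lact a (frame_represents i))
  (represents_ract a (frame_represents i))) _ => v.
by rewrite spinor_mul_mx subrr.
Qed.

Lemma d_frame a : d (iota a) = \sum_i val (e i) * iota (partial i a).
Proof.
apply/eqP; rewrite -subr_eq0; apply/eqP.
apply: represents_zero (representsB (represents_d a)
  (frame_coef_represents (partial^~ a))) _ => v.
by rewrite subrr.
Qed.

Lemma frame_free (b : 'I_2 -> smooth S) :
  \sum_i val (e i) * iota (b i) = 0 -> forall i, b i = 0.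
Proof.
move=> /(represents_eq0 (frame_coef_represents b)) /junk1_eq0.
exact: clifford_odd_free.
Qed.

(** The product is represented by $\gamma_i^2 = 1$, a scalar and hence junk, although the operator
    itself is not zero. *)
Lemma frame_sqr i : val (e i) * val (e i) = 0.
Proof.
have h := represents_wedge (frame_represents i) (frame_represents i).
have h1 : represents 2 (val (e i) * val (e i)) (spinor_mul rho (1 : smooth S)).
  by apply: represents_ext h => v; rewrite gammaK spinor_mul1.
apply/(represents_eq0 h1); exact: scalar_junk2.
Qed.

Lemma frame_anticomm :
  val (e ord_max) * val (e ord0) = - (val (e ord0) * val (e ord_max)).
Proof.
apply/eqP; rewrite -addr_eq0; apply/eqP.
have hw i j := represents_wedge (frame_represents i) (frame_represents j).
apply: represents_zero (representsD (hw _ _) (hw _ _)) _ => v.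
by rewrite gamma_anticomm addNr.
Qed.

(** Junk in degree two is scalar, and by [clifford_even_free] a multiple of $\gamma_1 \gamma_2$ is
    scalar only if it is zero. *)
Lemma frame_volume_free a :
  val (e ord0) * val (e ord_max) * iota a = 0 -> a = 0.
Proof.
have h := represents_wedge (frame_represents ord0) (represents_ract a
  (frame_represents ord_max)).
rewrite -mulrA => /(represents_eq0 h) /junk2_scalar[x hx].
have [] := @clifford_even_free (- x) a _; last by [].
by move=> v; rewrite spinor_mulNl -hx addNr.
Qed.

(** Whatever universal form represents $\gamma_i$, its coefficients are the constants $\delta_{ij}$,
    so its differential is represented by a scalar, that is, by junk. *)
Lemma d_frame_closed i : d (val (e i)) = 0.
Proof.
have [s [es sT]] := he i; rewrite es d_ueval1; apply/hOm.
suff cs j : coef j s = (j == i)%:R.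
  have -> : upi (udelta s) = spinor_mul rho
      (- \sum_j \sum_(p <- s) p.1 * partial j (partial j (thead p.2))).
    apply/funext => v; apply: udelta_scalar => j l; rewrite cs.
    by case: eqP => _; rewrite ?(partial0 hpartial) ?(partial1 hpartial).
  exact: scalar_junk2.
apply/eqP; rewrite -subr_eq0; apply/eqP; move: j.
apply: clifford_odd_free => v.
under eq_bigr do rewrite spinor_mulDl spinor_mxDr spinor_mulNl spinor_mxNr.
rewrite sumrB -upi1E sT (bigD1 i) //= eqxx spinor_mul1.
rewrite big1 ?addr0 ?subrr // => j ji.
by rewrite (negbTE ji) spinor_mul0l spinor_mx0r.
Qed.

End Connes.

(** * Levi-Civita connections of conformal metrics *)

Section TensorLemmas.
Local Set Implicit Arguments.
Local Unset Strict Implicit.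
Context {R : nzRingType}.
Implicit Types (M N Q : bimodType R).

Lemma tlift0 M N (G : zmodType) (f : M -> N -> G) : tens_balanced f ->
  tlift f 0 = 0.
Proof. by move=> hf; apply: (addrI (tlift f 0)); rewrite -tliftD // !addr0. Qed.

Lemma elem_tens0l M N (n : N) : (0 : M) \ot n = 0.
Proof. by apply: (addrI ((0 : M) \ot n)); rewrite -elem_tensDl !addr0. Qed.

Lemma elem_tens0r M N (m : M) : m \ot (0 : N) = 0.
Proof. by apply: (addrI (m \ot (0 : N))); rewrite -elem_tensDr !addr0. Qed.

Lemma elem_tens_suml M N (I : Type) (r : seq I) (f : I -> M) (n : N) :
  (\sum_(i <- r) f i) \ot n = \sum_(i <- r) (f i \ot n).
Proof.
exact: (big_morph (fun m => m \ot n)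
  (fun m m' => elem_tensDl m m' n) (elem_tens0l _ n)).
Qed.

Lemma ract_elem_tens M N (m : M) (n : N) a : ract (m \ot n) a = m \ot ract n a.
Proof. exact: tract_elem. Qed.

Lemma lact_elem_tens M N (m : M) (n : N) a : lact a (m \ot n) = lact a m \ot n.
Proof. exact: tlact_elem. Qed.

Section Assoc.
Context {M N Q : bimodType R}.

Lemma tens_assoc_balanced_in (q : Q) :
  tens_balanced (fun (m : M) (n : N) => m \ot (n \ot q)).
Proof.
split=> [m m' n|m n n'|m a n]; first exact: elem_tensDl.
  by rewrite elem_tensDl elem_tensDr.
by rewrite elem_tens_bal lact_elem_tens.
Qed.

Lemma tens_assoc_balanced :
  tens_balanced (fun mn (q : Q) =>
    tlift (fun (m : M) (n : N) => m \ot (n \ot q)) mn).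
Proof.
have hb := tens_assoc_balanced_in.
split=> [x y q|x q q'|x a q]; first exact: tliftD.
  elim/(@tens_ind R M N): x => [|x y hx hy|m n];
    first by rewrite !tlift0 // addr0.
    by rewrite !tliftD // hx hy addrACA.
  by rewrite !tlift_elem // !elem_tensDr.
elim/(@tens_ind R M N): x => [|x y hx hy|m n]; first by rewrite ract0 !tlift0.
  by rewrite ractDl !tliftD // hx hy.
by rewrite ract_elem_tens !tlift_elem // elem_tens_bal.
Qed.

Lemma tens_assoc_elem (m : M) (n : N) (q : Q) :
  tens_assoc ((m \ot n) \ot q) = m \ot (n \ot q).
Proof.
rewrite /tens_assoc tlift_elem; last exact: tens_assoc_balanced.
by rewrite tlift_elem //; exact: tens_assoc_balanced_in.
Qed.

Lemma tens_assoc_inv_balanced_in (m : M) :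
  tens_balanced (fun (n : N) (q : Q) => (m \ot n) \ot q).
Proof.
split=> [n n' q|n q q'|n a q].
- by rewrite elem_tensDr elem_tensDl.
- exact: elem_tensDr.
- by rewrite -ract_elem_tens elem_tens_bal.
Qed.

Lemma tens_assoc_inv_balanced :
  tens_balanced (fun (m : M) nq =>
    tlift (fun (n : N) (q : Q) => (m \ot n) \ot q) nq).
Proof.
have hb := tens_assoc_inv_balanced_in.
split=> [m m' x|m x y|m a x]; last 1 first.
- elim/(@tens_ind R N Q): x => [|x y hx hy|n q]; first by rewrite lact0 !tlift0.
    by rewrite lactDr !tliftD // hx hy.
  by rewrite lact_elem_tens !tlift_elem // elem_tens_bal.
- elim/(@tens_ind R N Q): x => [|x y hx hy|n q];
  first by rewrite !tlift0 // addr0.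
    by rewrite !tliftD // hx hy addrACA.
  by rewrite !tlift_elem // !elem_tensDl.
- exact: tliftD.
Qed.

Lemma tens_assoc_inv_elem (m : M) (n : N) (q : Q) :
  tens_assoc_inv (m \ot (n \ot q)) = (m \ot n) \ot q.
Proof.
rewrite /tens_assoc_inv tlift_elem; last exact: tens_assoc_inv_balanced.
by rewrite tlift_elem //; exact: tens_assoc_inv_balanced_in.
Qed.

Lemma id_tens_balanced (f : N -> Q) : {morph f : x y / x + y} ->
  (forall a x, f (lact a x) = lact a (f x)) ->
  tens_balanced (fun (m : M) n => m \ot f n).
Proof.
move=> fD fl; split=> [m m' n|m n n'|m a n]; first exact: elem_tensDl.
  by rewrite fD elem_tensDr.
by rewrite fl elem_tens_bal.
Qed.
End Assoc.

Lemma contract_balanced M N (g : M -> R) : right_functional g ->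
  tens_balanced (fun (m : M) (n : N) => lact (g m) n).
Proof.
move=> [gD gr]; split=> [m m' n|m n n'|m a n]; first by rewrite gD lactDl.
  exact: lactDr.
by rewrite gr lactM.
Qed.
End TensorLemmas.

(** * Conformal metrics over an abstract free, central and closed frame *)

Section ConformalMetric.
Local Set Implicit Arguments.
Local Unset Strict Implicit.
Context {C : numFieldType} {B : algType C} {Om : calculus B}.
Context {partial : 'I_2 -> B -> B} {e : 'I_2 -> Omega Om 1}.
Local Notation iota := (alg_incl Om).
Hypotheses (e_central : forall i a, iota a * val (e i) = val (e i) * iota a)
  (dE : forall a, dga_d Om (iota a) = \sum_i val (e i) * iota (partial i a))
  (e_free : forall b : 'I_2 -> B,
    \sum_i val (e i) * iota (b i) = 0 -> forall i, b i = 0)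
  (e_sqr : forall i, val (e i) * val (e i) = 0)
  (e_anticomm :
    val (e ord_max) * val (e ord0) = - (val (e ord0) * val (e ord_max)))
  (volume_free : forall a, val (e ord0) * val (e ord_max) * iota a = 0 -> a = 0)
  (e_closed : forall i, dga_d Om (val (e i)) = 0).
Implicit Types (a b : B).
Local Notation volume := (wedge1 (e ord0) (e ord_max)).

Lemma frame_central_elt i : central_elt (e i).
Proof. by move=> a; apply: val_inj; exact: e_central. Qed.

Lemma frame_rfree (b : 'I_2 -> B) :
  \sum_i ract (e i) (b i) = 0 -> forall i, b i = 0.
Proof. by move=> /(congr1 val); rewrite raddf_sum; exact: e_free. Qed.

Lemma d0E a : d0 Om a = \sum_i ract (e i) (partial i a).
Proof. by apply: val_inj; rewrite raddf_sum; exact: dE. Qed.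

Lemma d0_0 : d0 Om 0 = 0.
Proof. by apply: val_inj; rewrite /= rmorph0 linear0. Qed.

Lemma d0_1 : d0 Om 1 = 0.
Proof.
have deg1 : iota 1 \in deg Om 0 by apply/alg_incl_deg; exists 1.
apply: val_inj => /=; apply: (addrI (dga_d Om (iota 1))).
by have := dga_dM (iota 1) deg1; rewrite !rmorph1 !mul1r mulr1 addr0.
Qed.

Lemma volume_rfree a b : ract volume a = ract volume b -> a = b.
Proof.
move=> /(congr1 val) /= ab; apply/eqP; rewrite -subr_eq0; apply/eqP.
by apply: volume_free; rewrite rmorphB mulrBr ab subrr.
Qed.

(** Freeness of the volume form makes the coefficient chosen in [integral_form] unique. *)
Lemma integral_formE (phi : B -> C) a :
  integral_form phi e (ract volume a) = phi a.
Proof.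
by rewrite /integral_form (xget_unique _ (x := a)) //= => b /volume_rfree.
Qed.

Lemma wedge_balanced : tens_balanced (@wedge1 C B Om).
Proof.
split=> [x x' y|x y y'|x a y]; apply: val_inj => /=;
  by rewrite ?mulrDl ?mulrDr ?mulrA.
Qed.

Lemma wedge_map_frame (G : 'I_2 -> 'I_2 -> B) :
  wedge_map (\sum_j \sum_l ract (e j \ot e l) (G j l)) =
  ract volume (G ord0 ord_max - G ord_max ord0).
Proof.
rewrite !sum_ord2 !ract_elem_tens /wedge_map !(tliftD wedge_balanced).
rewrite !(tlift_elem _ _ wedge_balanced); apply: val_inj => /=.
rewrite !mulrA !e_sqr !mul0r e_anticomm add0r addr0 mulNr -mulrBr.
by rewrite rmorphB.
Qed.

Context {P : tens (Omega Om 1) (Omega Om 1) -> tens (Omega Om 1) (Omega Om 1)}.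
Hypothesis hP : tame_Psym P.

Lemma sigma_bimodule : bimodule_map (sigma P).
Proof.
have [[PD Pl Pr] _ _ _ _] := hP; split=> [x y|a x|x a]; rewrite /sigma.
- by rewrite PD mulrnDl opprD addrACA.
- by rewrite Pl !mulr2n -lactDr -lactN -lactDr.
- by rewrite Pr !mulr2n -ractDl -ractN -ractDl.
Qed.

Lemma sigma23D : {morph sigma23 P : x y / x + y}.
Proof.
have [sD sl _] := sigma_bimodule.
move=> x y; rewrite /sigma23 /tens_assoc (tliftD tens_assoc_balanced).
rewrite /id_tens (tliftD (id_tens_balanced sD sl)).
by rewrite /tens_assoc_inv (tliftD tens_assoc_inv_balanced).
Qed.

(** The coefficient is carried past [e j] by centrality and past [sigma P] by right linearity, so
    the flip only meets the central pair [e l], [e j]. *)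
Lemma sigma23_frame p l j a :
  sigma23 P (ract (e p \ot e l) a \ot e j) = (e p \ot e j) \ot ract (e l) a.
Proof.
have [sD sl sr] := sigma_bimodule; have [_ _ _ _ flip] := hP.
rewrite ract_elem_tens /sigma23 tens_assoc_elem elem_tens_bal frame_central_elt.
rewrite -(ract_elem_tens (e l)) /id_tens.
rewrite (tlift_elem _ _ (id_tens_balanced sD sl)) sr.
have -> : sigma P (e l \ot e j) = e j \ot e l.
  by apply: flip; exact: frame_central_elt.
by rewrite ract_elem_tens tens_assoc_inv_elem.
Qed.

Context {k : B} {g : tens (Omega Om 1) (Omega Om 1) -> B}.
Hypothesis hg : conformal_metric e k g.

Lemma metric_frame i j : g (e i \ot e j) = (i == j)%:R * k.
Proof.
have [_ h] := hg.
(* The coefficient matrix with single nonzero entry 1 at [(i, j)]. *)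
have := h (fun i' j' => ((i' == i) && (j' == j))%:R).
rewrite (bigD1 i) //= (bigD1 j) //= !eqxx ract1.
rewrite big1 ?addr0 => [|j' /negbTE ->]; last first.
  by rewrite ract0r elem_tens0r.
rewrite big1 ?addr0 => [|i' /negbTE ->]; last first.
  by apply: big1 => j' _; rewrite ract0r elem_tens0r.
move=> ->; rewrite (bigD1 i) //= eqxx big1 ?addr0 => [|i' /negbTE ->];
  last by rewrite mulr0.
by case: eqP; rewrite ?mulr1 ?mul1r ?mulr0 ?mul0r.
Qed.

(** After the flip the metric pairs [e p] with [e j], so only the summand $p = j$ survives. *)
Lemma contract_sigma23_frame (G : 'I_2 -> 'I_2 -> B) j :
  Defs.contract g
    (sigma23 P ((\sum_p \sum_l ract (e p \ot e l) (G p l)) \ot e j)) =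
  \sum_l ract (e l) (k * G j l).
Proof.
have [gfun _] := hg; have cb := contract_balanced (Omega Om 1) gfun.
have cD := tliftD cb; have c0 := tlift0 cb.
have s0 : sigma23 P 0 = 0 by apply: (addrI (sigma23 P 0));
  rewrite -sigma23D !addr0.
rewrite /Defs.contract elem_tens_suml (big_morph _ sigma23D s0) (big_morph _ cD
  c0).
rewrite (bigD1 j) //= [X in _ + X]big1 ?addr0 => [|p pj]; rewrite elem_tens_suml
  (big_morph _ sigma23D s0) (big_morph _ cD c0).
  apply: eq_bigr => l _; rewrite sigma23_frame (tlift_elem _ _ cb) metric_frame
    eqxx mul1r.
  by rewrite -lractA frame_central_elt -ractM.
apply: big1 => l _; rewrite sigma23_frame (tlift_elem _ _ cb) metric_frame.
by rewrite (negbTE pj) mul0r lact0r.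
Qed.

Context {nabla : Omega Om 1 -> tens (Omega Om 1) (Omega Om 1)}.
Context {Gamma : 'I_2 -> 'I_2 -> 'I_2 -> B}.
Hypotheses (hnabla : levi_civita P g nabla) (hGamma :
  christoffel e nabla Gamma).

(** As [e i] is closed, vanishing torsion says that the wedge of [nabla (e i)] is zero, and the
    volume form is free. *)
Lemma christoffel_sym i : Gamma i ord0 ord_max = Gamma i ord_max ord0.
Proof.
have [_ torsion _] := hnabla; have := torsion (e i).
have -> : d1 (e i) = 0 by apply: val_inj; exact: e_closed.
rewrite addr0 hGamma wedge_map_frame => /(congr1 val) /volume_free /eqP.
by rewrite subr_eq0 => /eqP.
Qed.

(** Metric compatibility on the central pair [e i], [e j] with right factor 1, whose differential
    vanishes; freeness of the frame then compares coefficients. *)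
Lemma christoffel_metric i j l :
  k * (Gamma i j l + Gamma j i l) = if i == j then partial l k else 0.
Proof.
have [_ _ [_ /(_ (e i) (e j) 1 (@frame_central_elt i) (@frame_central_elt j))]]
  := hnabla.
rewrite !ract1 d0_1 lact0 addr0 metric_frame sigma23D /Defs.contract.
rewrite (tliftD (contract_balanced (Omega Om 1) hg.1)) -!/(Defs.contract _ _)
  !hGamma !contract_sigma23_frame.
rewrite -big_split /= => h; apply/eqP; rewrite -subr_eq0; apply/eqP; move: l.
apply: (@frame_rfree (fun l => _ - _)); under eq_bigr do rewrite ractDr mulrDr
  ractDr.
rewrite big_split /= -h.
case: eqP => _; first by rewrite mul1r d0E -big_split big1 // => l _ /=;
  rewrite -ractDr subrr ract0r.
by rewrite mul0r d0_0 add0r big1 // => l _; rewrite oppr0 ract0r.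
Qed.

(* With [K_l = k^-1 (partial_l k) / 2] the Christoffel symbols are
   [Gamma^i_jl = delta_ij K_l + delta_il K_j - delta_jl K_i], and the quadratic
   terms of the curvature cancel. *)
Lemma curvature12_conformal (k' : B) : k' * k = 1 ->
  let K l := 2^-1 *: (k' * partial l k) in
  curvature12 partial e Gamma =
    ract volume (- partial ord_max (K ord_max) + partial ord0 (- K ord0)).
Proof.
move=> k'k K.
have GE i j l : Gamma i j l + Gamma j i l = if i == j then K l + K l else 0.
  rewrite -[LHS]mul1r -k'k -mulrA christoffel_metric; case: eqP => _;
    last by rewrite mulr0.
  by rewrite -scalerDl; have -> : 2^-1 + 2^-1 = 1 :> C;
    [field | rewrite scale1r].
have Gd i l : Gamma i i l = K l.
  apply/eqP; rewrite -subr_eq0; apply/eqP/addrr_eq0; rewrite addrACA -opprD.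
  by rewrite GE eqxx subrr.
have G21 := Gd ord_max ord0.
have Gs1 := christoffel_sym ord0; have Gs2 := christoffel_sym ord_max.
(* Compatibility gives $\Gamma^1_{22} = -\Gamma^2_{12}$, and by symmetry $\Gamma^2_{12} =
   \Gamma^2_{21} = K_1$. *)
have G122 : Gamma ord0 ord_max ord_max = - K ord0.
  by apply/eqP; rewrite -addr_eq0 -{1}G21 -Gs2 GE.
(* The summand $p = 1$ is $K_2^2 + K_1^2$ and $p = 2$ is $-K_1^2 - K_2^2$. Only squares occur, so
   the cancellation requires no commutation. *)
rewrite /curvature12; congr ract; rewrite sum_ord2 -Gs1 !Gd G122; congr (_ + _).
by rewrite mulrN mulNr opprK -opprD [K ord0 * _ + _]addrC subrr add0r.
Qed.
End ConformalMetric.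

Theorem corollary5p10
  (R : realType) (A : cstarType R) (S : 'I_2 -> A)
  (hA : (exists theta : R, nc_torus theta S) \/ reduced_free_group_cstar S)
  (alpha : ('I_2 -> R[i]) -> A -> A) (halpha : torus_action S alpha)
  (tau : A -> R[i]) (htau : tracial_state tau) (htau_inv : invariant_state alpha tau)
  (partial : 'I_2 -> smooth S -> smooth S)
  (hpartial : canonical_derivations partial)
  (tau0 : A -> R[i]) (htau0 : faithful_state tau0)
  (H : hilbertType R) (rho : A -> H -> H) (xi : H) (hGNS : GNS tau0 rho xi)
  (gamma : 'I_2 -> 'M[R[i]]_2) (hgamma : clifford gamma)
  (Om : calculus (smooth S)) (hOm : connes_calculus rho xi gamma partial Om)
  (e : 'I_2 -> Omega Om 1)
  (he : canonical_frame (S := S) rho xi gamma partial (Om := Om) e)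
  (P : tens (Omega Om 1) (Omega Om 1) -> tens (Omega Om 1) (Omega Om 1))
  (hP : tame_Psym P) :
  exists c : R[i],
    forall (k : smooth S) (g : tens (Omega Om 1) (Omega Om 1) -> smooth S)
      (nabla : Omega Om 1 -> tens (Omega Om 1) (Omega Om 1))
      (Gamma : 'I_2 -> 'I_2 -> 'I_2 -> smooth S),
      deformation_parameter k ->
      conformal_metric e k g ->
      levi_civita P g nabla ->
      christoffel e nabla Gamma ->
      integral_form (fun a : smooth S => tau (val a)) e (curvature12 partial e Gamma) = c.
Proof.
have [unitS genS] := torus_or_free_unitary_generated S hA.
have hC := partialC hpartial halpha.
have vol := frame_volume_free genS hpartial hC htau0 hGNS hgamma hOm he.
exists 0 => k g nabla Gamma [k' [_ k'k]] hg hnabla hGamma.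
have {}k'k : k' * k = 1 by exact: val_inj.
rewrite (curvature12_conformal
  (frame_central genS hpartial htau0 hGNS hOm he)
  (d_frame genS hpartial htau0 hGNS hOm he)
  (frame_free genS hpartial htau0 hGNS hgamma hOm he)
  (frame_sqr genS unitS hpartial hC htau0 hGNS hgamma hOm he)
  (frame_anticomm genS hpartial htau0 hGNS hgamma hOm he)
  vol (d_frame_closed genS unitS hpartial hC htau0 hGNS hgamma hOm he)
  hP hg hnabla hGamma k'k).
(* With the sign moved inside, the coefficient is a sum of two derivatives, each of which [tau]
   annihilates. *)
rewrite (integral_formE vol) -(partialN hpartial) /= stateD; last exact: htau.1.
by rewrite !(invariant_state_partial hpartial halpha) ?addr0 //; exact: htau.1.
Qed.
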